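(* For every integer $n \geq 4$ there exist natural numbers $a_1, a_2, \ldots, a_n$ such that the polynomial $f_n(x) := (x^2 - a_1)(x^2 - a_2)\cdots(x^2 - a_n)$ is minimally intersective. In fact, for every $n \geq 4$ one can choose natural numbers $a_1, \ldots, a_{n-1}$ such that the set of natural numbers $a_n$ for which $f_n(x) = (x^2-a_1)\cdots(x^2-a_{n-1})(x^2-a_n)$ is minimally intersective has positive asymptotic density.
   Context: A set $S \subset \mathbb{Z}$ is called intersective if for every $T \subset \mathbb{Z}$ with positive upper density one has $S \cap (T - T) \not\subseteq \{0\}$, where $T - T = \{t_1 - t_2 : t_1, t_2 \in T\}$ and the upper density of $T$ is $\overline{d}(T) := \limsup_{N\to\infty} \frac{|T \cap \{-N, \ldots, N\}|}{2N+1}$. A polynomial $f(x) \in \mathbb{Z}[x]$ is called intersective if the set $\{f(x) : x \in \mathbb{Z}\}$ is intersective; by a theorem of Kamae and Mendès-France this is equivalent to the congruence $f(x) \equiv 0 \pmod m$ being solvable in integers for every integer $m > 1$ (i.e. $f$ has a root modulo every positive integer). A polynomial $f(x) \in \mathbb{Z}[x]$ is called minimally intersective if (1) $f(x)$ is intersective but has no rational root, and (2) no proper divisor of $f(x)$ is intersective. Here a proper divisor of the monic polynomial $f$ means a divisor of $f$ in $\mathbb{Z}[x]$ of degree strictly smaller than $\deg f$. The asymptotic density of a set $A \subset \mathbb{N}$ is $\lim_{N\to\infty} \frac{|A \cap \{1, 2, \ldots, N\}|}{N}$. *)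

(* Defs.v *)
From mathcomp Require Import all_boot all_order all_algebra finmap.
From mathcomp Require Import all_classical all_reals all_analysis.

Set Implicit Arguments.
Unset Strict Implicit.
Unset Printing Implicit Defensive.

Import Order.TTheory GRing.Theory Num.Theory.
Import numFieldNormedType.Exports.

Local Open Scope classical_set_scope.
Local Open Scope ring_scope.

(* The sets counted by [fset_set] below are finite, so [fset_set] does not
   fall back on its default value [fset0]. *)

Definition upper_density (R : realType) (T : set int) : \bar R :=
  limn_esup (fun N : nat =>
    ((#|` fset_set (T `&` `[- N%:Z, N%:Z]) |)%:R / (N.*2.+1)%:R : R)%:E).

Definition difference_set (T : set int) : set int :=
  [set t1 - t2 | t1 in T & t2 in T].

Definition intersective_set (R : realType) (S : set int) : Prop :=
  forall T : set int, (0 < upper_density R T)%E ->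
    ~ (S `&` difference_set T `<=` [set 0]).

Definition intersective_poly (R : realType) (f : {poly int}) : Prop :=
  intersective_set R (range (fun x : int => f.[x])).

(* Divisibility in Z[x]; the library's [%|] on [{poly int}] is only
   divisibility up to a nonzero integer factor. *)
Definition poly_int_divides (g f : {poly int}) : Prop :=
  exists h : {poly int}, f = h * g.

Definition minimally_intersective (R : realType) (f : {poly int}) : Prop :=
  [/\ intersective_poly R f,
      forall q : rat, ~~ root (map_poly intr f) q
    & forall g : {poly int}, poly_int_divides g f -> (size g < size f)%N ->
        ~ intersective_poly R g].

Definition has_asymptotic_density (R : realType) (A : set nat) (d : R) : Prop :=
  (fun N : nat => (#|` fset_set (A `&` `[1%N, N]) |)%:R / N%:R : R) @ \oo --> d.

Definition quadratic_product (m : nat) (a : 'I_m -> nat) : {poly int} :=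
  \prod_(i < m) ('X^2 - ((a i)%:Z)%:P).

(* Main.v *)
Require Import Defs.
From mathcomp Require Import all_boot all_order all_algebra.
From mathcomp Require Import all_classical all_reals all_analysis.
From mathcomp Require Import all_field fingroup cyclic finmap zify ring lra.

(** A product of factors x^2 - a is controlled by congruences.  A monic
    nonconstant f in Z[x] is intersective exactly when it has a root modulo
    every positive integer, a theorem of Kamae and Mendes-France.  Testing f on
    the multiples of m gives one direction.  For the other, let T contain no
    difference equal to a positive value of f.  Weyl differencing shows that the
    mean of z ^ f(r + m y) over a long range of y is small unless z ^ (q D) is
    close to 1 for some bounded q, where D depends only on m and on the degree
    ([weyl]).  Take r to be a root of f modulo m and use K scales, each modulus
    being divisible by all the numbers q D of the previous scale: if the mean at
    some scale is large, then at all scales with a more divisible modulus the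
    powers of z are close to 1.  Hence at most one scale harms the average over
    the scales, which yields finitely many weighted values of f whose Fourier
    transform has real part at least -2/K on the unit circle, while it equals 1
    at z = 1 ([almost_positive]).  Pairing it with the squared Fourier
    coefficients of T in a long interval, the total is 0, the trivial character
    contributes the square of the number of elements, and so the density of T is
    O(1/K) ([no_difference_sparse]).

    Over Z[x] a divisor of smaller degree divides the product of all the factors
    but one, so minimality means that no single factor may be removed; by the
    Chinese remainder theorem, local solvability means that for each prime p one
    of the a's is a p-adic square ([minimally_intersective_quadratics],
    [locally_solvable_quadratics]).

    The coefficients are built from n - 3 primes p = 3 mod 4 larger than 7.  With
    P their product, let a = P (u^2 + 1), c = 420^2 a - 1 and consider a, c, a c.
    One of the three is a square modulo any odd prime not dividing a c; modulo a
    prime dividing c, a is the square of 1/420; modulo a prime dividing u^2 + 1,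
    c = -1 = u^2; and the residues modulo 8 make one of them a 2-adic square.
    At a prime p of the list, a and a c have odd valuation and c = -1 is not a
    square, so all three fail there.  For each p one adds a number which is a
    square at p and at none of the other primes of the list: it cannot be
    removed.  Finally u is chosen so that among all n numbers the only square
    modulo 3 is a, the only square modulo 5 is c, and the only square modulo 7 is
    a c, so that none of these can be removed either ([minimal_configuration]).
    The conditions on each added number only concern its residue modulo 105 P, so
    the last coefficient b may range over a whole residue class.

    It remains to see that the set of good b has a density.  For fixed a's, f has
    roots modulo everything exactly when b is a p-adic square at every prime p
    where none of the a's is one.  If there are finitely many such p, this
    condition is periodic up to a periodic set of small density; if there are
    infinitely many, it defines a set of density 0.  Sets which are periodic up to
    arbitrarily small periodic sets form a Boolean algebra and have a density
    ([almost_periodic_density]), and minimality is a Boolean combination of such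
    conditions ([almost_periodic_minimally_intersective]). *)

Set Implicit Arguments.
Unset Strict Implicit.
Unset Printing Implicit Defensive.

Import Order.TTheory GRing.Theory Num.Theory.
Import numFieldNormedType.Exports.

Local Open Scope classical_set_scope.
Local Open Scope ring_scope.

(** * Weyl sums over the unit circle *)

Lemma norm_sum_shift (C : numClosedFieldType) (u : nat -> C) (Y h : nat) :
  (forall y, `|u y| <= 1) ->
  `|\sum_(y < Y) u (y + h)%N - \sum_(y < Y) u y| <= h.*2%:R.
Proof.
move=> u1; elim: h => [|h IH].
  by under eq_bigr do rewrite addn0; rewrite subrr normr0.
have -> : \sum_(y < Y) u (y + h.+1)%N
          = \sum_(y < Y) u (y + h)%N + (u (Y + h)%N - u h).
  have := erefl (\sum_(y < Y.+1) u (y + h)%N).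
  rewrite {1}big_ord_recr big_ord_recl /= add0n.
  under [X in _ = _ + X -> _]eq_bigr do rewrite /bump /= add1n addSnnS.
  by move=> e; rewrite addrA e addrAC subrr add0r.
rewrite addrAC doubleS -addn2 natrD.
apply: le_trans (ler_normD _ _) _; apply: lerD => //.
by apply: le_trans (ler_normB _ _) _; rewrite (lerD (u1 _) (u1 _)).
Qed.

(** Averaging the sum over the H = K^2 shifts of its range and expanding the
    square leaves H diagonal terms and the correlations of the sequence with its
    own shifts.  The factor 4 absorbs the boundary terms. *)
Lemma van_der_corput (C : numClosedFieldType) (u : nat -> C) (K Y : nat) :
  (0 < K)%N -> (K ^ 4 <= Y)%N -> (forall y, `|u y| <= 1) ->
  (forall h, (0 < h < K ^ 2)%N ->
     (K ^ 2)%:R * `|\sum_(y < Y) u (y + h)%N * (u y)^*| <= Y%:R) ->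
  K%:R * `|\sum_(y < Y) u y| <= 4 * Y%:R.
Proof.
move=> K0 leKY u1 corr; set H := (K ^ 2)%N.
have H0 : (0 < H)%N by rewrite expn_gt0 K0.
have HHY : (H * H <= Y)%N by rewrite -expnD.
have KR : 0 < K%:R :> C by rewrite ltr0n.
have HR : 0 < H%:R :> C by rewrite ltr0n.
have HHYR : H%:R * H%:R <= Y%:R :> C by rewrite -natrM ler_nat.
have HK : H%:R = K%:R * K%:R :> C by rewrite -natrM mulnn.
pose V y := \sum_(h < H) u (y + h)%N.
have Cuv x y : `|u x * (u y)^*| <= 1.
  by rewrite normrM norm_conjC mulr_ile1.
have offdiag h h' : (h' < h < H)%N ->
    H%:R * `|\sum_(y < Y) u (y + h)%N * (u (y + h')%N)^*|
      <= Y%:R + 2 * (H%:R * H%:R).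
  case/andP=> hh' hH.
  have -> : \sum_(y < Y) u (y + h)%N * (u (y + h')%N)^* =
    (\sum_(y < Y) u (y + h' + (h - h'))%N * (u (y + h')%N)^*
      - \sum_(y < Y) u (y + (h - h'))%N * (u y)^*)
    + \sum_(y < Y) u (y + (h - h'))%N * (u y)^*.
    by rewrite subrK; apply: eq_bigr => y _; rewrite -addnA subnKC // ltnW.
  apply: le_trans (ler_wpM2l (ltW HR) (ler_normD _ _)) _.
  rewrite mulrDr addrC; apply: lerD.
    by apply: corr; rewrite subn_gt0 hh' (leq_ltn_trans (leq_subr _ _)).
  rewrite mulrCA; apply: ler_wpM2l; first exact: ltW.
  apply: le_trans (@norm_sum_shift _ (fun y => u (y + (h - h'))%N * (u y)^*) _ _ _) _.
    by move=> y; apply: Cuv.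
  rewrite -muln2 mulnC natrM ler_wpM2l // ler_nat.
  exact: leq_trans (ltnW hh') (ltnW hH).
have pair h h' : (h < H)%N -> (h' < H)%N ->
    H%:R * `|\sum_(y < Y) u (y + h)%N * (u (y + h')%N)^*|
      <= (h == h')%:R * (H%:R * Y%:R) + (Y%:R + 2 * (H%:R * H%:R)).
  move=> hH h'H; case: (ltngtP h h') => [lt|lt|<-]; rewrite ?mul0r ?add0r.
  - rewrite -norm_conjC rmorph_sum /=.
    under eq_bigr do rewrite rmorphM /= conjCK mulrC.
    by rewrite offdiag ?lt.
  - by rewrite offdiag ?lt.
  rewrite mul1r; apply: ler_wpDr; first by rewrite addr_ge0 // !mulr_ge0 // ler0n.
  apply: ler_wpM2l; first exact: ltW.
  apply: le_trans (ler_norm_sum _ _ _) _.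
  apply: le_trans (ler_sum _ (fun i _ => Cuv _ _)) _.
  by rewrite sumr_const card_ord.
have sumV2 : \sum_(y < Y) `|V y| ^+ 2 <= 4 * (H%:R * Y%:R).
  rewrite -(ler_pM2l HR).
  have -> : \sum_(y < Y) `|V y| ^+ 2 =
      \sum_(h < H) \sum_(h' < H) \sum_(y < Y) u (y + h)%N * (u (y + h')%N)^*.
    under [RHS]eq_bigr do rewrite exchange_big /=.
    rewrite [RHS]exchange_big /=; apply: eq_bigr => y _.
    rewrite normCK rmorph_sum mulr_suml; apply: eq_bigr => h _.
    by rewrite mulr_sumr.
  apply: le_trans (_ : \sum_(h < H) \sum_(h' < H)
      ((h == h')%:R * (H%:R * Y%:R) + (Y%:R + 2 * (H%:R * H%:R))) <= _).
    rewrite -[X in X <= _]ger0_norm; last first.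
      apply: mulr_ge0; first exact: ltW.
      under eq_bigr do rewrite exchange_big /=.
      rewrite exchange_big /=; apply: sumr_ge0 => y _.
      suff -> : \sum_(i < H) \sum_(j < H) u (y + i)%N * (u (y + j)%N)^* = `|V y| ^+ 2.
        by rewrite exprn_ge0.
      rewrite normCK rmorph_sum mulr_suml; apply: eq_bigr => h _.
      by rewrite mulr_sumr.
    rewrite normrM (ger0_norm (ltW HR)).
    apply: le_trans (ler_wpM2l (ltW HR) (ler_norm_sum _ _ _)) _.
    rewrite mulr_sumr; apply: ler_sum => h _.
    apply: le_trans (ler_wpM2l (ltW HR) (ler_norm_sum _ _ _)) _.
    rewrite mulr_sumr; apply: ler_sum => h' _.
    exact: pair.
  under eq_bigr => h _.
    rewrite big_split /= (bigD1 h) //= eqxx mul1r big1 ?addr0; last first.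
      by move=> i ne; rewrite eq_sym (negPf ne) mul0r.
    rewrite sumr_const card_ord; over.
  rewrite sumr_const card_ord -(mulr_natr (_ + _ *+ _)) -(mulr_natr (_ + _) H).
  set h := H%:R; set y := Y%:R; rewrite -/h -/y in HR HHYR *.
  have -> : (h * y + (y + 2 * (h * h)) * h) * h
    = 2 * (h * (h * y)) + 2 * (h * (h * (h * h))) by ring.
  have -> : h * (4 * (h * y)) = 2 * (h * (h * y)) + 2 * (h * (h * y)) by ring.
  by rewrite lerD2l ler_pM2l // !ler_pM2l.
(* The inequality 4 K |v| <= |v|^2 + 4 K^2 replaces Cauchy-Schwarz. *)
have sumV : \sum_(y < Y) `|V y| <= 2 * (K%:R * Y%:R).
  have K4 : 0 < 4 * K%:R :> C by rewrite mulr_gt0.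
  rewrite -(ler_pM2l K4) mulr_sumr.
  apply: le_trans (_ : \sum_(y < Y) (`|V y| ^+ 2 + 4 * H%:R) <= _).
    apply: ler_sum => y _; rewrite -subr_ge0 HK.
    have -> : `|V y| ^+ 2 + 4 * (K%:R * K%:R) - 4 * K%:R * `|V y|
            = (`|V y| - 2 * K%:R) ^+ 2 by ring.
    by rewrite real_exprn_even_ge0 // rpredB // ?normr_real // rpredM // realn.
  rewrite big_split /= sumr_const card_ord -(mulr_natr (4 * _)).
  have -> : 4 * K%:R * (2 * (K%:R * Y%:R)) = 4 * (H%:R * Y%:R) + 4 * H%:R * Y%:R :> C.
    by rewrite HK; ring.
  by rewrite lerD2r.
have HS : H%:R * `|\sum_(y < Y) u y| <= \sum_(y < Y) `|V y| + 2 * (H%:R * H%:R).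
  have -> : H%:R * `|\sum_(y < Y) u y|
     = `|\sum_(y < Y) V y - \sum_(h < H) (\sum_(y < Y) u (y + h)%N - \sum_(y < Y) u y)|.
    rewrite sumrB sumr_const card_ord exchange_big /= opprB addrCA subrr addr0.
    by rewrite -(mulr_natl (\sum_(y < Y) u y)) normrM normr_nat.
  apply: le_trans (ler_normB _ _) _; apply: lerD; first exact: ler_norm_sum.
  apply: le_trans (ler_norm_sum _ _ _) _.
  apply: le_trans (_ : \sum_(h < H) (2 * H%:R) <= _).
    apply: ler_sum => h _; apply: le_trans (@norm_sum_shift _ u Y h u1) _.
    by rewrite -muln2 mulnC natrM ler_wpM2l // ler_nat ltnW.
  by rewrite sumr_const card_ord -(mulr_natr (2 * _)) mulrA.
rewrite -(ler_pM2l KR) mulrA -HK; apply: le_trans HS _.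
apply: le_trans (lerD sumV (lexx _)) _.
have -> : K%:R * (4 * Y%:R) = 2 * (K%:R * Y%:R) + 2 * (K%:R * Y%:R) :> C by ring.
rewrite lerD2l ler_wpM2l //; apply: le_trans HHYR _.
by rewrite -natrM ler_nat leq_pmull.
Qed.

(** A polynomial sequence of degree at most d, described by its differences
    only: all iterated differences of order d with steps h_1, ..., h_d are equal
    to h_1 ... h_d D.  For a polynomial D is d! times the coefficient of degree
    d.  This is the form on which Weyl differencing operates. *)
Fixpoint poly_seq (d : nat) (D : int) (p : nat -> int) : Prop :=
  if d is d'.+1 then
    forall h : nat, poly_seq d' (h%:Z * D) (fun y => p (y + h)%N - p y)
  else forall y, p y = D.

Lemma eq_poly_seq d D p q : p =1 q -> poly_seq d D p -> poly_seq d D q.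
Proof.
elim: d D p q => [|d IH] D p q pq /=; first by move=> pD y; rewrite -pq.
by move=> Hp h; apply: IH (Hp h) => y; rewrite !pq.
Qed.

Lemma horner_poly_seq (d : nat) (f : {poly int}) : (size f <= d.+1)%N ->
  poly_seq d (d`!%:Z * f`_d) (fun y => f.[y%:Z]).
Proof.
elim: d f => [|d IH] f szf /=.
  by move=> y; rewrite [f](size1_polyC szf) hornerC coefC /= mul1r.
move=> h.
pose g := \sum_(i < d.+1) (h%:Z ^+ i.+1) *: f^`N(i.+1).
have gE y : g.[y%:Z] = f.[(y + h)%N%:Z] - f.[y%:Z].
  rewrite PoszD (nderiv_taylor_wide _ szf); last exact: mulrC.
  rewrite big_ord_recl /= nderivn0 expr0 mulr1 addrC addKr.
  by rewrite horner_sum; apply: eq_bigr => i _; rewrite hornerZ mulrC.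
have coefg k : g`_k = \sum_(i < d.+1)
    h%:Z ^+ i.+1 * (f`_(i.+1 + k) *+ 'C(i.+1 + k, i.+1)).
  by rewrite coef_sum; apply: eq_bigr => i _; rewrite coefZ coef_nderivn.
have szg : (size g <= d.+1)%N.
  apply/leq_sizeP => k dk; rewrite coefg big1 // => i _.
  by rewrite nth_default ?mul0rn ?mulr0 //; apply: leq_trans szf _; rewrite addSn ltnS; lia.
have gd : g`_d = h%:Z * (d.+1%:Z * f`_d.+1).
  rewrite coefg big_ord_recl /= big1 => [|i _].
    by rewrite addr0 expr1 add1n bin1 -mulr_natl natz.
  rewrite nth_default ?mul0rn ?mulr0 //; apply: leq_trans szf _.
  by rewrite /bump /=; lia.
apply: eq_poly_seq gE _.
have -> : h%:Z * ((d.+1)`!%:Z * f`_d.+1) = d`!%:Z * g`_d.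
  by rewrite gd factS PoszM; ring.
exact: IH.
Qed.

Lemma conjC_exprz (C : numClosedFieldType) (z : C) (k : int) :
  `|z| = 1 -> (z ^ k)^* = z ^ (- k).
Proof.
move=> z1; have zV : z^* = z^-1 by rewrite invC_norm z1 expr1n invr1 mul1r.
by rewrite -exprz_inv -zV rmorphXz ?unitfE // -normr_gt0 z1.
Qed.

Lemma norm_exprz (C : numClosedFieldType) (z : C) (k : int) :
  `|z| = 1 -> `|z ^ k| = 1.
Proof. by move=> z1; case: k => n; rewrite /exprz ?normfV normrX z1 expr1n ?invr1. Qed.

(** Weyl's inequality in a qualitative form.  The bound M on the multipliers
    depends neither on eta nor on the range Y: in [almost_positive] it determines
    a modulus, on which the choice of eta depends in turn.
    In degree 1 the sum is geometric; each further degree costs one application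
    of van der Corput's inequality. *)
Lemma weyl (C : archiClosedFieldType) (d K : nat) : (0 < K)%N ->
  exists2 M : nat, (0 < M)%N & forall eta : C, 0 < eta ->
  exists Y0 : nat, forall (Y : nat) (D : int) (p : nat -> int) (z : C),
    (Y0 <= Y)%N -> poly_seq d.+1 D p -> `|z| = 1 ->
    (forall q : nat, (0 < q <= M)%N -> eta <= `|z ^ (q%:Z * D) - 1|) ->
    K%:R * `|\sum_(y < Y) z ^ p y| <= Y%:R.
Proof.
elim: d K => [|d IH] K K0.
  exists 1%N => // eta eta0; exists (Num.bound (2 * K%:R / eta)).
  move=> Y D p z leY /= pD z1 far.
  have pE (y : nat) : z ^ p y = z ^ p 0%N * (z ^ D) ^+ y.
    have := pD y 0%N; rewrite add0n => /eqP; rewrite subr_eq => /eqP ->.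
    by rewrite expfzDr -?normr_gt0 ?z1 // mulrC [_ * D]mulrC -exprz_exp.
  under eq_bigr do rewrite pE.
  rewrite -mulr_sumr normrM norm_exprz // mul1r.
  have etaD : eta <= `|z ^ D - 1| by have := far 1%N isT; rewrite mul1r.
  rewrite -(ler_pM2r eta0).
  apply: le_trans (_ : K%:R * (`|z ^ D - 1| * `|\sum_(i < Y) (z ^ D) ^+ i|) <= _).
    by rewrite -mulrA ler_wpM2l // mulrC ler_wpM2r.
  rewrite -normrM -subrX1.
  apply: le_trans (_ : K%:R * 2 <= _).
    apply: ler_wpM2l => //; apply: le_trans (ler_normB _ _) _.
    by rewrite normrX norm_exprz // expr1n normr1.
  have : 2 * K%:R / eta <= Y%:R.
    apply: le_trans (ltW (archi_boundP _)) _; last by rewrite ler_nat.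
    by rewrite divr_ge0 // ?mulr_ge0 // ltW.
  by rewrite ler_pdivrMr // mulrC.
(* Van der Corput's inequality is used with 4 K, to absorb its constant 4. *)
have H0 : (0 < (4 * K) ^ 2)%N by rewrite expn_gt0 muln_gt0 K0.
have [M M0 HM] := IH _ H0.
(* Differencing with step h multiplies the top difference by h, so a multiplier
   q for the differences is a multiplier q h for p. *)
exists (M * (4 * K) ^ 2)%N; first by rewrite muln_gt0 M0.
move=> eta eta0; have [Y0 HY0] := HM _ eta0.
exists (maxn Y0 ((4 * K) ^ 4)) => Y D p z; rewrite geq_max => /andP[Y0Y KY].
move=> pD z1 far.
have z0 : z != 0 by rewrite -normr_gt0 z1.
rewrite -(ler_pM2l (ltr0n _ 4)) mulrA -natrM.
apply: (@van_der_corput _ (fun y => z ^ p y)) => //.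
- by rewrite muln_gt0.
- by move=> y; rewrite norm_exprz.
move=> h /andP[h0 hK].
under eq_bigr do rewrite conjC_exprz // -expfzDr //.
apply: (HY0 _ (h%:Z * D) (fun y => p (y + h)%N - p y)) => // q /andP[q0 qM].
have := far (q * h)%N; rewrite PoszM mulrA; apply.
by rewrite muln_gt0 q0 h0 leq_mul // ltnW.
Qed.

(** * Values of a polynomial and differences of a dense set *)

(** The congruence condition in the theorem of Kamae and Mendes-France. *)
Definition locally_solvable (f : {poly int}) : Prop :=
  forall m : nat, (0 < m)%N -> exists x : int, (m%:Z %| f.[x])%Z.

Lemma dvdz_horner_sub (f : {poly int}) (x y : int) : (x - y %| f.[x] - f.[y])%Z.
Proof.
have /factor_theorem[g fE] : root (f - f.[y]%:P) y.
  by rewrite /root !hornerE subrr.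
have : (f - f.[y]%:P).[x] = g.[x] * (x - y) by rewrite fE !hornerE.
by rewrite !hornerE => ->; apply: dvdz_mull.
Qed.

Lemma norm_exprz_sub1 (C : numClosedFieldType) (w : C) (k : int) :
  `|w| = 1 -> `|w ^ k - 1| <= `|k|%N%:R * `|w - 1|.
Proof.
move=> w1; have nat_case (n : nat) : `|w ^+ n - 1| <= n%:R * `|w - 1|.
  rewrite subrX1 normrM mulrC ler_wpM2r //.
  apply: le_trans (ler_norm_sum _ _ _) _.
  by under eq_bigr do rewrite normrX w1 expr1n; rewrite sumr_const card_ord.
case: k => n; first exact: nat_case.
rewrite NegzE abszN absz_nat -exprnN.
have wn : w ^+ n.+1 != 0 by rewrite -normr_gt0 normrX w1 expr1n.
suff -> : `|w ^- n.+1 - 1| = `|w ^+ n.+1 - 1| by apply: nat_case.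
have -> : w ^- n.+1 - 1 = - (w ^- n.+1 * (w ^+ n.+1 - 1)).
  by rewrite mulrBr mulVf // mulr1 opprB.
by rewrite normrN normrM normfV normrX w1 expr1n invr1 mul1r.
Qed.

Lemma lerN_Re (C : numClosedFieldType) (w : C) : - `|w| <= 'Re w.
Proof.
have [h _] := leif_normC_Re_Creal w.
by rewrite lerNl; apply: le_trans h; rewrite -normrN real_ler_norm // rpredN Creal_Re.
Qed.

(** The top difference of y -> f (r + m y) does not depend on r. *)
Lemma horner_arith_progression (f : {poly int}) (d m : nat) (r : int) :
  f \is monic -> size f = d.+1 -> (0 < m)%N ->
  poly_seq d (d`!%:Z * m%:Z ^+ d) (fun y => f.[r + m%:Z * y%:Z]).
Proof.
move=> fmon szf m0; pose q : {poly int} := m%:Z *: 'X + r%:P.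
have m0' : m%:Z != 0 by rewrite -lt0n.
have szX : size (m%:Z *: 'X : {poly int}) = 2 by rewrite size_scale ?size_polyX.
have szq : size q = 2.
  by rewrite size_polyDl szX // (leq_ltn_trans (size_polyC_leq1 _)).
have lq : lead_coef q = m%:Z.
  rewrite lead_coefDl; last by rewrite szX (leq_ltn_trans (size_polyC_leq1 _)).
  by rewrite lead_coefZ lead_coefX mulr1.
have szfq : (size (f \Po q)).-1 = d by rewrite size_comp_poly szf szq muln1.
have lfq : lead_coef (f \Po q) = m%:Z ^+ d.
  by rewrite lead_coef_comp ?szq // (monicP fmon) mul1r lq szf.
apply: (@eq_poly_seq _ _ (fun y => (f \Po q).[y%:Z])).
  by move=> y; rewrite /= horner_comp !hornerE addrC.
rewrite -lfq lead_coefE szfq.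
by apply: horner_poly_seq; rewrite -szfq leqSpred.
Qed.

(** A finite measure of mass k carried by positive values of f divisible by m,
    with almost nonnegative Fourier transform.  The induction adds to a measure
    obtained for a much more divisible modulus m' a long mean over a progression
    of modulus m.  Where this mean is not small, some z ^ (q D) is so close to 1
    that all the terms of the former measure, whose exponents are multiples of
    q D, have nonnegative real part; elsewhere the mean costs at most 1/K.  The
    total loss is therefore at most 1, for a single bad scale, plus k/K. *)
Lemma almost_positive (C : archiClosedFieldType) (f : {poly int}) (K k : nat) :
  f \is monic -> (1 < size f)%N -> locally_solvable f -> (0 < K)%N ->
  forall m : nat, (0 < m)%N -> exists s : seq (C * int),
  [/\ {in s, forall v, [/\ 0 <= v.1, exists x, v.2 = f.[x], 0 < v.2
                         & (m%:Z %| v.2)%Z]},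
      \sum_(v <- s) v.1 = k%:R
    & forall z : C, `|z| = 1 ->
        - (1 + k%:R / K%:R) <= 'Re (\sum_(v <- s) v.1 * z ^ v.2)].
Proof.
move=> fmon szf floc K0; elim: k => [|k IH] m m0.
  exists [::]; split=> // [|z z1]; rewrite ?big_nil //.
  by rewrite ['Re _]raddf0 mul0r addr0 lerN10.
have KR : 0 < K%:R :> C by rewrite ltr0n.
pose d := (size f).-2; have szfd : size f = d.+2 by rewrite /d; case: (size f) szf => [|[]].
have [M M0 HM] := @weyl C d K K0.
pose D := (d.+1)`!%:Z * m%:Z ^+ d.+1 : int.
(* Every q D with 0 < q <= M divides m'. *)
pose m' := (m * M`! * `|D|)%N.
have D0 : D != 0.
  by rewrite mulf_neq0 ?expf_neq0 // -lt0n ?fact_gt0.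
have m'0 : (0 < m')%N by rewrite !muln_gt0 m0 fact_gt0 absz_gt0.
have [s' [s'val s'sum s'Re]] := IH _ m'0.
pose B := (\sum_(v <- s') `|v.2|).+1%N.
have leB v : v \in s' -> (`|v.2| <= B)%N.
  by move=> vs; rewrite ltnW // ltnS (big_rem _ vs) leq_addr.
have BR : 0 < B%:R :> C by rewrite ltr0n.
have [Y0 HY0] := HM _ (divr_gt0 ltr01 BR).
pose Y := Y0.+1; have YR : 0 < Y%:R :> C by rewrite ltr0n.
have [b fpos] := monic_Cauchy_bound fmon.
have [r0 r0m] := floc _ m0.
(* The root is moved up its class, to where f is positive. *)
pose r := r0 + m%:Z * (`|r0| + `|b|)%N%:Z.
have rb : b <= r.
  rewrite /r PoszD; case: m m0 {r0m D m' D0 m'0 s'val r} => // m _.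
  by rewrite -addn1 PoszD mulrDl mul1r; nia.
pose x (y : nat) := r + m%:Z * y%:Z.
pose s := [seq (Y%:R^-1 : C, f.[x y]) | y <- index_iota 0 Y] ++ s'.
have fx_m y : (m%:Z %| f.[x y])%Z.
  rewrite -(subrK f.[r0] f.[x y]) rpredD //.
  apply: dvdz_trans (dvdz_horner_sub f _ _).
  have -> : x y - r0 = m%:Z * ((`|r0| + `|b|)%N%:Z + y%:Z) by rewrite /x /r; ring.
  exact: dvdz_mulr.
exists s; split.
- move=> v; rewrite mem_cat => /orP[/mapP[y _ ->]|vs'] /=.
    split; [by rewrite invr_ge0 ler0n|by exists (x y)| |exact: fx_m].
    by apply: fpos; apply: le_trans rb _; rewrite lerDl mulr_ge0.
  have [v1 v2 v0 vm'] := s'val _ vs'; split=> //.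
  by apply: dvdz_trans vm'; rewrite /m' -mulnA PoszM dvdz_mulr.
- rewrite big_cat big_map /= s'sum sumr_const_nat subn0 -(mulr_natr _^-1) mulVf ?gt_eqF //.
  by rewrite -natr1 addrC.
move=> z z1.
rewrite big_cat big_map big_mkord /= -mulr_sumr ['Re _]raddfD /=.
set S := \sum_(i < Y) z ^ _; set T := \sum_(v <- s') _.
have RS : 'Re (Y%:R^-1 * S) >= - 1.
  apply: (le_trans _ (lerN_Re _)); rewrite lerN2 normrM normfV normr_nat mulrC.
  rewrite ler_pdivrMr // mul1r; apply: le_trans (ler_norm_sum _ _ _) _.
  by under eq_bigr do rewrite norm_exprz //; rewrite sumr_const card_ord.
have [/existsP[q /andP[q0 near]]|far] :=
  boolP [exists q : 'I_M.+1, (0 < q)%N && (`|z ^ (q%:Z * D) - 1| < 1 / B%:R)].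
  have RT : 0 <= 'Re T.
    rewrite /T raddf_sum big_seq_cond; apply: sumr_ge0 => v; rewrite andbT => vs'.
    have [v1 _ _ vm'] := s'val _ vs'.
    rewrite /= ReMl ?ger0_real // mulr_ge0 //.
    have /dvdzP[t vt] : (q%:Z * D %| v.2)%Z.
      apply: dvdz_trans vm'; rewrite dvdzE abszM !absz_nat; apply: dvdn_mul => //.
      by rewrite dvdn_mull // dvdn_fact // q0 -ltnS ltn_ord.
    have v0 : v.2 != 0 by have [_ _ /lt0r_neq0] := s'val _ vs'.
    have tB : (`|t| <= B)%N.
      apply: leq_trans (leB _ vs'); rewrite vt abszM leq_pmulr // absz_gt0.
      by apply: contraNneq v0 => e; rewrite vt e mulr0.
    have zv : `|z ^ v.2 - 1| <= 1.
      rewrite vt mulrC -exprz_exp.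
      apply: le_trans (norm_exprz_sub1 _ (norm_exprz _ z1)) _.
      apply: le_trans (_ : B%:R * (1 / B%:R) <= _); last first.
        by rewrite mul1r mulfV ?gt_eqF.
      by apply: ler_pM => //; rewrite ?ler_nat // ltW.
    have -> : z ^ v.2 = 1 + (z ^ v.2 - 1) by rewrite addrC subrK.
    rewrite ['Re _]raddfD /= (Creal_ReP 1 _) ?rpred1 //.
    have := lerN_Re (z ^ v.2 - 1); rewrite -(lerD2l 1); apply: le_trans.
    by rewrite subr_ge0.
  apply: (le_trans _ (lerD RS RT)); rewrite addr0 lerN2 lerDl.
  by rewrite divr_ge0.
have RS' : - K%:R^-1 <= 'Re (Y%:R^-1 * S).
  apply: (le_trans _ (lerN_Re _)); rewrite lerN2 normrM normfV normr_nat.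
  rewrite mulrC ler_pdivrMr // -(ler_pM2l KR) mulrA mulfV ?gt_eqF // mul1r.
  apply: (HY0 Y D (fun y => f.[x y])) => //; first exact: horner_arith_progression.
  move=> q /andP[q0 qM]; rewrite (real_leNgt _ (normr_real _)); last first.
    by rewrite ger0_real // divr_ge0.
  apply: contra far => near; apply/existsP; exists (Ordinal (qM : (q < M.+1)%N)).
  by rewrite q0.
apply: (le_trans _ (lerD RS' (s'Re _ z1))).
by rewrite -opprD lerN2 -natr1 mulrDl mul1r addrC addrA.
Qed.

(** Orthogonality of the characters of the integers modulo L. *)
Lemma sum_unity_root (F : fieldType) (L : nat) (w : F) (n : int) :
  L.-primitive_root w -> (0 < `|n| < L)%N -> \sum_(j < L) (w ^ n) ^+ j = 0.
Proof.
move=> prim /andP[n0 nL].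
have wL := prim_expr_order prim.
have wabs : w ^+ `|n| != 1.
  by rewrite -(prim_order_dvd prim) gtnNdvd.
have wn : w ^ n - 1 != 0.
  rewrite subr_eq0; case: n {n0 nL} wabs => m //= wabs.
  by rewrite NegzE -invr_expz invr_eq1; apply: contra wabs.
apply: (mulfI wn); rewrite mulr0 -subrX1.
have -> : (w ^ n) ^+ L = (w ^+ L) ^ n by apply: (exprzAC w n L).
by rewrite wL exp1rz subrr.
Qed.

(** Parseval's identity modulo L = W + B, where B exceeds every value of f in
    the support of the measure, so that no difference wraps around.  The
    hypothesis on E makes the pairing of the squared Fourier coefficients of E
    with the measure vanish; the trivial character contributes #|E|^2 K, and the
    others at least -2 L #|E|. *)
Lemma no_difference_sparse (C : archiClosedFieldType) (f : {poly int}) (K : nat) :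
  (forall n : nat, (0 < n)%N -> {z : C | n.-primitive_root z}) ->
  f \is monic -> (1 < size f)%N -> locally_solvable f -> (0 < K)%N ->
  exists B : nat, forall (W : nat) (E : {set 'I_W}),
    (forall (t t' : 'I_W) (x : int), t \in E -> t' \in E -> 0 < f.[x] ->
       t%:Z - t'%:Z <> f.[x]) ->
    (K * #|E| <= 2 * (W + B))%N.
Proof.
move=> prim_ex fmon szf floc K0.
have [s [sval ssum sRe]] := @almost_positive C f K K fmon szf floc K0 1 isT.
pose B := (\sum_(v <- s) `|v.2|).+1%N.
have leB v : v \in s -> (`|v.2| < B)%N.
  by move=> vs; rewrite ltnS (big_rem _ vs) leq_addr.
exists B => W E noE; pose L := (W + B)%N.
have L0 : (0 < L)%N by rewrite /L /B addnS.
have [w prim] := prim_ex L L0.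
have w1 : `|w| = 1.
  apply/eqP; rewrite -(@pexpr_eq1 _ _ L) // -normrX (prim_expr_order prim).
  by rewrite normr1.
have w0 : w != 0 by rewrite -normr_gt0 w1.
pose F j := \sum_(t in E) (w ^ t%:Z) ^+ j.
have F2 (j : nat) : `|F j| ^+ 2 = \sum_(t in E) \sum_(t' in E) (w ^ (t%:Z - t'%:Z)) ^+ j.
  rewrite normCK rmorph_sum mulr_suml; apply: eq_bigr => t _.
  rewrite mulr_sumr; apply: eq_bigr => t' _.
  by rewrite rmorphXn /= conjC_exprz // -exprMn -expfzDr.
have parseval : \sum_(j < L) `|F j| ^+ 2 = L%:R * #|E|%:R.
  under eq_bigr do rewrite F2.
  rewrite exchange_big /= mulr_natr -sumr_const; apply: eq_bigr => t tE.
  rewrite exchange_big /= (bigD1 t) //= [X in _ + X]big1 ?addr0 => [|t' /andP[t'E ne]].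
    by under eq_bigr do rewrite subrr expr0z expr1n; rewrite sumr_const card_ord.
  apply: sum_unity_root prim _.
  have := ltn_ord t; have := ltn_ord t'.
  have : (t' : nat) <> t by move=> e; case/eqP: ne; apply: val_inj.
  rewrite /L; lia.
pose Phi j := \sum_(v <- s) v.1 * (w ^+ j) ^ v.2.
have PhiRe (j : nat) : - 2 <= 'Re (Phi j).
  have := sRe (w ^+ j); rewrite normrX w1 expr1n => /(_ erefl).
  by rewrite divff // pnatr_eq0 -lt0n.
have vanish : \sum_(j < L) `|F j| ^+ 2 * Phi j = 0.
  under eq_bigr do rewrite F2 mulr_sumr.
  rewrite exchange_big /= big_seq big1 // => v vs.
  have [_ [x vx] v0 _] := sval _ vs.
  under eq_bigr do rewrite mulrCA mulr_suml.
  rewrite -mulr_sumr exchange_big /= big1 ?mulr0 // => t tE.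
  under eq_bigr do rewrite mulr_suml.
  rewrite exchange_big /= big1 // => t' t'E.
  transitivity (\sum_(j < L) (w ^ (t%:Z - t'%:Z + v.2)) ^+ j).
    apply: eq_bigr => j _; rewrite (expfzDr (t%:Z - t'%:Z) v.2 w0) exprMn.
    by congr (_ * _); apply: (exprzAC w j).
  apply: sum_unity_root prim _.
  have := ltn_ord t; have := ltn_ord t'; have := leB _ vs.
  have : t'%:Z - t%:Z <> v.2 by rewrite vx; apply: noE => //; rewrite -vx.
  rewrite /L; lia.
have F0 : F 0%N = #|E|%:R by rewrite /F sumr_const.
have Phi0 : 'Re (Phi 0%N) = K%:R.
  rewrite /Phi; under eq_bigr do rewrite expr0 exp1rz mulr1.
  by rewrite ssum (Creal_ReP _ _) ?realn.
have key : #|E|%:R ^+ 2 * (K%:R + 2) <= 2 * (L%:R * #|E|%:R) :> C.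
  have -> : 2 * (L%:R * #|E|%:R) = \sum_(j < L) `|F j| ^+ 2 * ('Re (Phi j) + 2) :> C.
    under eq_bigr do rewrite mulrDr.
    rewrite big_split /= -mulr_suml parseval mulrC -[LHS]add0r; congr (_ + _).
    transitivity ('Re (\sum_(j < L) `|F j| ^+ 2 * Phi j)).
      by rewrite vanish (Creal_ReP 0 _) ?rpred0.
    rewrite raddf_sum; by apply: eq_bigr => j _; rewrite /= ReMl // rpredX // normr_real.
  rewrite (bigD1 (Ordinal L0)) //= F0 Phi0 normr_nat lerDl sumr_ge0 // => j _.
  by rewrite mulr_ge0 ?exprn_ge0 // -(lerD2r (- 2)) add0r addrK.
have [->|E0] := posnP #|E|; first by rewrite muln0.
rewrite -/L -(ler_nat C) -(ler_pM2l (_ : 0 < #|E|%:R :> C)) ?ltr0n //.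
rewrite !natrM; apply: le_trans (le_trans _ key) _.
  by rewrite mulrCA -expr2 mulrC ler_wpM2l ?exprn_ge0 // lerDl.
by rewrite mulrA mulrC.
Qed.

Lemma card_fset_set_seq (T : choiceType) (A : set T) (s : seq T) :
  uniq s -> (forall x, A x <-> x \in s) -> #|` fset_set A| = size s.
Proof.
move=> us As; have As' : A = [set` s] by apply/seteqP; split=> x /As.
apply/perm_size/uniq_perm => [||x]; rewrite ?fset_uniq //.
have finA : finite_set A by rewrite As'; apply: finite_seq.
by rewrite in_fset_set //; apply/idP/idP => [/set_mem/As|/As/mem_set].
Qed.

Definition window (T : set int) (N : nat) : {set 'I_(N.*2.+1)} :=
  [set i : 'I_(N.*2.+1) | `[< T (i%:Z - N%:Z) >]]%SET.

Lemma card_window (T : set int) (N : nat) :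
  #|` fset_set (T `&` `[- N%:Z, N%:Z])| = #|window T N|.
Proof.
rewrite (@card_fset_set_seq _ _ [seq (nat_of_ord i)%:Z - N%:Z | i <- enum (window T N)]).
- by rewrite size_map -cardE.
- rewrite map_inj_uniq ?enum_uniq // => i j /addIr[] ij.
  exact: val_inj.
move=> t; split=> [[Tt]|/mapP[i]].
  rewrite /= in_itv /= => /andP[tl tr].
  have tN : (absz (t + N%:Z)%R < N.*2.+1)%N by lia.
  apply/mapP; exists (Ordinal tN); last by rewrite /=; lia.
  rewrite mem_enum inE; apply/asboolP => /=.
  by have -> : (absz (t + N%:Z)%R)%:Z - N%:Z = t by lia.
rewrite mem_enum inE => /asboolP Ti ->; split=> //=.
by rewrite in_itv /=; have := ltn_ord i; lia.
Qed.

Lemma upper_density_ge (R : realType) (T : set int) (c : R) :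
  (forall N, c * (N.*2.+1)%:R <= #|window T N|%:R) ->
  (c%:E <= upper_density R T)%E.
Proof.
move=> cT; apply: le_ereal_inf_tmp => _ [V Voo <-].
have [N _ VN] := Voo; apply: le_trans (ereal_sup_ubound _); last first.
  by exists N; [apply: VN => /=|reflexivity].
by rewrite lee_fin card_window ler_pdivlMr ?ltr0n.
Qed.

Lemma upper_density_le (R : realType) (T : set int) (c : R) (N0 : nat) :
  (forall N, (N0 <= N)%N -> #|window T N|%:R <= c * (N.*2.+1)%:R) ->
  (upper_density R T <= c%:E)%E.
Proof.
move=> Tc.
apply: le_trans (_ : (ereal_sup ((fun N => (#|window T N|%:R / (N.*2.+1)%:R : R)%:E)
   @` [set N | (N0 <= N)%N]) <= _)%E).
  apply: ereal_inf_lbound; exists [set N | (N0 <= N)%N]; first by exists N0.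
  by congr (ereal_sup _); apply: eq_imagel => N _; rewrite card_window.
apply: ge_ereal_sup => _ [N /= NN <-].
by rewrite lee_fin ler_pdivrMr ?ltr0n // Tc.
Qed.

(** The multiples of m have positive density and their differences are again
    multiples of m. *)
Lemma intersective_locally_solvable (R : realType) (f : {poly int}) :
  intersective_poly R f -> locally_solvable f.
Proof.
move=> fint m m0; pose T : set int := [set t | (m%:Z %| t)%Z].
suff : ~ (range (fun x : int => f.[x]) `&` difference_set T `<=` [set 0]).
  move=> /existsNP[_ /not_implyP[[[x _ <-] [t1 Tt1 [t2 Tt2 e]]] _]].
  by exists x; rewrite -e; apply: rpredB.
apply: fint; apply: lt_le_trans (@upper_density_ge R T (m.*2%:R)^-1 _).
  by rewrite lte_fin invr_gt0 ltr0n double_gt0.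
move=> N; rewrite mulrC ler_pdivrMr ?ltr0n ?double_gt0 // -natrM ler_nat.
pose q := (N %/ m)%N.
have qm : (N - q * m < m)%N by rewrite {1}(divn_eq N m) addKn ltn_mod.
have qN : (q * m <= N)%N by rewrite leq_divM.
suff leq : (q.+1 <= #|window T N|)%N.
  by apply: leq_trans (leq_mul leq (leqnn _)); nia.
pose g (k : 'I_q.+1) : 'I_(N.*2.+1) := inord (N + k * m).
have gE k : g k = (N + k * m)%N :> nat.
  by rewrite inordK //; have := ltn_ord k; nia.
have ginj : injective g.
  move=> k l /(congr1 val); rewrite /= !gE => /addnI/eqP.
  by rewrite eqn_pmul2r // => /eqP /val_inj.
rewrite -[q.+1]card_ord -(card_imset _ ginj); apply/subset_leq_card/fintype.subsetP.
move=> _ /imsetP[k _ ->]; rewrite inE; apply/asboolP; rewrite /T /= gE.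
by rewrite PoszD addrC addKr PoszM dvdz_mull.
Qed.

(** The hard half of the theorem of Kamae and Mendes-France, for monic
    polynomials. *)
Lemma locally_solvable_intersective (R : realType) (f : {poly int}) :
  f \is monic -> (1 < size f)%N -> locally_solvable f -> intersective_poly R f.
Proof.
move=> fmon szf floc T Tpos noT.
suff small K : (0 < K)%N -> (upper_density R T <= (4 / K%:R)%:E)%E.
  case: (upper_density R T) Tpos small => [r|//|//] r0 small; last first.
    by have := small 1%N isT.
  move: r0; rewrite lte_fin => r0.
  have := small (Num.bound (4 / r)).+1 isT; rewrite lee_fin.
  rewrite ler_pdivlMr ?ltr0n // mulrC -ler_pdivlMr // leNgt => /negP; apply.
  apply: lt_trans (archi_boundP _) _; first by rewrite divr_ge0 // ltW.
  by rewrite ltr_nat.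
move=> K0.
have [B sparse] := @no_difference_sparse algC f K (@C_prim_root_exists) fmon szf floc K0.
apply: (@upper_density_le _ _ _ B) => N BN.
have := sparse _ (window T N).
set W := (N.*2.+1)%N; move=> H.
have {}H : (K * #|window T N| <= 4 * W)%N.
  apply: leq_trans (H _) _; last by rewrite /W; lia.
  move=> t t' x; rewrite !inE => /asboolP Tt /asboolP Tt' fx0 e.
  have : f.[x] = 0.
    apply: noT; split; first by exists x.
    exists (t%:Z - N%:Z) => //; exists (t'%:Z - N%:Z) => //.
    by rewrite -e; ring.
  by move=> f0; rewrite f0 ltxx in fx0.
rewrite mulrAC ler_pdivlMr ?ltr0n // -!natrM ler_nat mulnC.
exact: H.
Qed.

(** * Products of quadratic factors and p-adic squares *)

Definition square_mod (m a : nat) : bool := [exists x : 'I_m, x ^ 2 == a %[mod m]]%N.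

Lemma square_modP (m a : nat) : (0 < m)%N ->
  reflect (exists x : int, (m%:Z %| x ^+ 2 - a%:Z)%Z) (square_mod m a).
Proof.
move=> m0; apply: (iffP existsP) => [[x /eqP e]|[x]].
  exists (x : nat)%:Z; rewrite -eqz_mod_dvd -rmorphXn /= !modz_nat eqz_nat.
  by rewrite e.
have mz : m%:Z != 0 by rewrite -lt0n.
have x0 := modz_ge0 x mz; have xm := ltz_mod x mz.
have xm' : (`|(x %% m)%Z| < m)%N by lia.
move=> h; exists (Ordinal xm').
have -> : nat_of_ord (Ordinal xm') = `|(x %% m)%Z|%N by [].
rewrite -eqz_nat -!modz_nat PoszM.
have -> : (`|(x %% m)%Z|%N%:Z = (x %% m)%Z) by lia.
by rewrite modzMm eqz_mod_dvd -expr2.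
Qed.

Lemma square_mod_dvd (m m' a : nat) : (0 < m')%N -> (m %| m')%N ->
  square_mod m' a -> square_mod m a.
Proof.
move=> m0 mm' /(square_modP _ m0)[x hx]; apply/square_modP.
  exact: dvdn_gt0 mm'.
by exists x; apply: dvdz_trans hx.
Qed.

Lemma eq_square_mod (m a b : nat) : (a = b %[mod m])%N ->
  square_mod m a = square_mod m b.
Proof. by move=> e; apply: eq_existsb => x; rewrite e. Qed.

Lemma square_mod_sqr (m x : nat) : (0 < m)%N -> square_mod m (x ^ 2).
Proof.
by move=> m0; apply/square_modP => //; exists x%:Z; rewrite -rmorphXn subrr dvdz0.
Qed.

Definition padic_square (p a : nat) : Prop := forall k, square_mod (p ^ k) a.

Definition quadratics (s : seq nat) : {poly int} :=
  \prod_(a <- s) ('X^2 - (a%:Z)%:P).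

Lemma horner_quadratics s x : (quadratics s).[x] = \prod_(a <- s) (x ^+ 2 - a%:Z).
Proof.
by rewrite horner_prod; apply: eq_bigr => a _; rewrite !hornerE.
Qed.

Lemma monic_quadratics s : quadratics s \is monic.
Proof. by apply: monic_prod => a _; rewrite monicXnsubC. Qed.

Lemma size_quadratics s : size (quadratics s) = (size s).*2.+1.
Proof.
elim: s => [|a s IH]; first by rewrite /quadratics big_nil size_poly1.
rewrite /quadratics big_cons size_monicM ?monicXnsubC ?monic_neq0 ?monic_quadratics //.
by rewrite IH size_XnsubC // doubleS.
Qed.

Lemma prime_power_dvdM (p j k : nat) (u v : int) : prime p ->
  ((p ^ (j + k))%N%:Z %| u * v)%Z ->
  ((p ^ j)%N%:Z %| u)%Z \/ ((p ^ k)%N%:Z %| v)%Z.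
Proof.
move=> pp; rewrite !dvdzE !absz_nat abszM.
have [->|u0] := posnP `|u|%N; first by left; rewrite dvdn0.
have [->|v0] := posnP `|v|%N; first by right; rewrite dvdn0.
rewrite !pfactor_dvdn ?muln_gt0 ?u0 // lognM // => h.
by case: (leqP j (logn p `|u|)) => [|lt]; [left|right; lia].
Qed.

(** If no a is a p-adic square, each factor misses some power of p; a power of p
    with exponent larger than the sum of these cannot divide a value of the
    product.  The converse glues the local roots by the Chinese remainder
    theorem, one prime power at a time. *)
Lemma locally_solvable_quadratics (s : seq nat) :
  locally_solvable (quadratics s) <->
  (forall p, prime p -> exists2 a, a \in s & padic_square p a).
Proof.
split=> [sol p pp|sq m].
  have p0 k : (0 < p ^ k)%N by rewrite expn_gt0 prime_gt0.
  suff [//|[K noK]] : (exists2 a, a \in s & padic_square p a) \/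
      exists K, forall x, ~ ((p ^ K)%N%:Z %| (quadratics s).[x])%Z.
    by have [x /noK] := sol _ (p0 K).
  elim: s {sol} => [|a s [[b bs sqb]|[K noK]]].
  - right; exists 1%N => x; rewrite horner_quadratics big_nil dvdz1 absz_nat expn1.
    by move=> /eqP p1; rewrite p1 in pp.
  - by left; exists b => //; rewrite inE bs orbT.
  have [sqa|/existsNP[k nok]] := pselect (padic_square p a).
    by left; exists a; rewrite ?mem_head.
  right; exists (k + K)%N => x; rewrite /quadratics big_cons hornerM => h.
  case: (prime_power_dvdM pp h) => [h1|]; last exact: noK.
  by apply: nok; apply/square_modP => //; exists x; rewrite !hornerE in h1.
elim/ltn_ind: m => m IH m0.
have [m1|m1] := leqP m 1.
  by exists 0; rewrite (_ : m = 1)%N ?dvd1z //; lia.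
have pp := pdiv_prime m1; set p := pdiv m in pp.
have [a sa sqa] := sq _ pp.
have mE := partnC p m0; rewrite p_part in mE.
set k := logn p m in mE; set m' := (m`_p^')%N in mE.
have m'0 : (0 < m')%N by apply: part_gt0.
have pk1 : (1 < p ^ k)%N.
  rewrite (leq_trans (prime_gt1 pp)) // -{1}(expn1 p) leq_exp2l ?prime_gt1 //.
  by rewrite logn_gt0 mem_primes pp m0 pdiv_dvd.
have [x0 hx0] : exists x : int, (m'%:Z %| (quadratics s).[x])%Z.
  by apply: IH => //; rewrite -mE ltn_Pmull.
have [y hy] := square_modP a (ltnW pk1) (sqa k).
have cop : coprimez (p ^ k)%N m'.
  by rewrite coprimezE !absz_nat /k /m' -p_part coprime_partC.
set x := zchinese (p ^ k)%N m' y x0; exists x.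
have lift (n : int) u : (x = u %[mod n])%Z -> (n %| (quadratics s).[u])%Z ->
    (n %| (quadratics s).[x])%Z.
  move=> /eqP; rewrite eqz_mod_dvd => e hu.
  rewrite -(subrK (quadratics s).[u] (quadratics s).[x]) rpredD //.
  exact: dvdz_trans e (dvdz_horner_sub _ _ _).
rewrite -mE PoszM Gauss_dvdz //; apply/andP; split.
  apply: lift (zchinese_modl cop y x0) _.
  by rewrite horner_quadratics (big_rem _ sa) /= dvdz_mulr.
exact: lift (zchinese_modr cop y x0) hx0.
Qed.

Lemma root_quadratics (F : fieldType) (s : seq nat) (x : F) :
  root (map_poly intr (quadratics s)) x -> exists2 a, a \in s & x ^+ 2 = a%:R.
Proof.
rewrite rootE -[map_poly _ _]/(map_poly (intr : {rmorphism int -> F}) _).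
rewrite /quadratics rmorph_prod horner_prod prodf_seq_eq0 => /hasP[a sa /=].
rewrite rmorphB /= map_polyXn map_polyC !hornerE subr_eq0 => /eqP e.
by exists a.
Qed.

Lemma rat_sqr_nat (q : rat) (a : nat) : q ^+ 2 = a%:R -> exists z : nat, a = (z ^ 2)%N.
Proof.
move=> qa; have d0 : (denq q)%:~R != 0 :> rat by rewrite intr_eq0 denq_neq0.
have e : numq q ^+ 2 = a%:Z * denq q ^+ 2.
  apply: (@intr_inj rat); rewrite rmorphXn rmorphM rmorphXn /=.
  by rewrite numqE exprMn qa.
have d1 : `|denq q|%N = 1%N.
  have := coprime_num_den q; rewrite coprime_sym => /(coprimeXr 2) cop.
  apply/eqP; rewrite -dvdn1 -(Gauss_dvdr _ cop) muln1 -abszX e abszM dvdn_mull //.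
  by rewrite abszX dvdn_exp.
exists `|numq q|%N; rewrite -abszX e abszM abszX d1 exp1n muln1.
by rewrite absz_nat.
Qed.

Lemma quadratics_rem (s : seq nat) a : a \in s ->
  quadratics s = ('X^2 - (a%:Z)%:P) * quadratics (rem a s).
Proof. exact: big_rem. Qed.

Lemma locally_solvable_sqr (s : seq nat) (z : nat) :
  (z ^ 2)%N \in s -> locally_solvable (quadratics s).
Proof.
move=> zs m m0; exists z%:Z; rewrite horner_quadratics (big_rem _ zs) /=.
by rewrite -rmorphXn subrr mul0r.
Qed.

Lemma rem_mem_rem (T : eqType) (s : seq T) (a : T) : (1 < size s)%N -> a \in s ->
  exists2 b, b \in s & a \in rem b s.
Proof.
case: s => [|x [|y s]] //= _; rewrite inE.
have [->|ne] := eqVneq a x => /= [_|as'].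
  have [xy|nxy] := eqVneq x y; last first.
    by exists y; rewrite ?inE ?eqxx ?orbT // (negPf nxy) mem_head.
  by exists x; rewrite ?mem_head // eqxx -xy mem_head.
by exists x; rewrite ?mem_head // eqxx.
Qed.

(** If f = h g with h nonconstant, a complex root alpha of h satisfies
    alpha^2 = a for some a in s.  Since f has no rational root, alpha is
    irrational, so the remainder of h modulo x^2 - a, of degree at most 1 and
    vanishing at alpha, is zero.  Then g divides the product of the other
    factors.  Rational roots are excluded by the same condition: a factor
    x^2 - z^2 has an integer root, so every other factor could be removed. *)
Lemma minimally_intersective_quadratics (R : realType) (s : seq nat) :
  (1 < size s)%N ->
  minimally_intersective R (quadratics s) <->
  locally_solvable (quadratics s) /\
  {in s, forall a, ~ locally_solvable (quadratics (rem a s))}.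
Proof.
move=> s1; have szs : (1 < size (quadratics s))%N.
  by rewrite size_quadratics; lia.
split=> [[fint _ fmin]|[floc fmin]].
  split; first exact: intersective_locally_solvable fint.
  move=> a sa remloc; apply: (fmin (quadratics (rem a s))).
  - by exists ('X^2 - (a%:Z)%:P); apply: quadratics_rem.
  - by rewrite !size_quadratics size_rem // ltnS ltn_double ltn_predL ltnW.
  apply: locally_solvable_intersective remloc; first exact: monic_quadratics.
  by rewrite size_quadratics size_rem //; case: (size s) s1 => [|[]].
have norat q : ~~ root (map_poly intr (quadratics s)) (q : rat).
  apply/negP => /root_quadratics[a sa /rat_sqr_nat[z az]].
  have [b bs ab] := rem_mem_rem s1 sa.
  by apply: (fmin b bs); apply: (@locally_solvable_sqr _ z); rewrite -az.
split=> // [|g [h fE] szg /intersective_locally_solvable gloc].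
  by apply: locally_solvable_intersective floc; first exact: monic_quadratics.
have f0 : quadratics s != 0 by rewrite monic_neq0 ?monic_quadratics.
have [h0 g0] : h != 0 /\ g != 0 by apply/andP; rewrite -negb_or -mulf_eq0 -fE.
have szh : (1 < size h)%N.
  move: szg; rewrite fE size_mul //; case: (size h) => [|[|k]] // lt; exfalso; move: lt.
    by rewrite add0n ltnNge leq_pred.
  by rewrite add1n ltnn.
pose c := (intr : {rmorphism int -> algC}).
have szhc : size (map_poly c h) = size h.
  by apply: size_map_inj_poly; [exact: intr_inj|exact: rmorph0].
have [alpha halpha] : exists x, root (map_poly c h) x.
  by apply/closed_rootP; rewrite szhc; lia.
have [a sa aE] : exists2 a, a \in s & alpha ^+ 2 = a%:R.
  by apply: root_quadratics; rewrite fE rmorphM rootM halpha.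
have qmon : 'X^2 - (a%:Z)%:P \is monic by rewrite monicXnsubC.
have hE := Pdiv.IdomainMonic.divp_eq qmon h.
set r := h %% _ in hE; set h' := h %/ _ in hE.
have szr : (size r <= 2)%N.
  by have := ltn_modp h ('X^2 - (a%:Z)%:P); rewrite monic_neq0 // size_XnsubC.
have rE : r = (r`_1)%:P * 'X + (r`_0)%:P.
  apply/polyP => i; rewrite coefD coefMX !coefC.
  case: i => [|[|i]] //=; rewrite ?add0r ?addr0 //.
  by rewrite nth_default // (leq_trans szr).
move: (r`_1) (r`_0) rE => u v rE.
have ralpha : c u * alpha + c v = 0.
  move: halpha; rewrite rootE hE rE !rmorphD !rmorphM rmorphB /=.
  rewrite !map_polyC map_polyX map_polyXn /= !hornerE /= aE -pmulrn subrr mulr0 add0r.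
  by move/eqP.
have u0 : u = 0.
  apply/eqP; apply: contraT => u0; case/negP: (norat (- v%:~R / u%:~R)).
  rewrite (quadratics_rem sa) rmorphM rootM; apply/orP; left.
  rewrite rootE rmorphB /= map_polyXn map_polyC !hornerE subr_eq0.
  have uq : u%:~R != 0 :> rat by rewrite intr_eq0.
  rewrite expr_div_n sqrrN -(inj_eq (mulIf (expf_neq0 2 uq))) divfK ?expf_neq0 //.
  have : c (a%:Z * u ^+ 2) = c (v ^+ 2).
    rewrite rmorphM !rmorphXn /= -pmulrn -aE -exprMn mulrC.
    by move/eqP: ralpha; rewrite addr_eq0 => /eqP ->; rewrite sqrrN.
  by move/intr_inj => e; rewrite -!rmorphXn -rmorphM /= e.
have v0 : v = 0.
  by apply: (@intr_inj algC); move: ralpha; rewrite u0 rmorph0 mul0r add0r => ->.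
have r00 : r = 0 by rewrite rE u0 v0 mul0r add0r.
apply: (fmin a sa) => m m0; have [x gx] := gloc m m0; exists x.
suff -> : quadratics (rem a s) = h' * g by rewrite hornerM dvdz_mull.
apply: (mulfI (monic_neq0 qmon)).
by rewrite -quadratics_rem // fE hE r00 addr0 mulrA [h' * _]mulrC.
Qed.

(** * Squares modulo primes and prime powers *)

(** Hensel's lemma: Newton's step, with u an inverse of 2 x modulo p. *)
Lemma padic_square_odd (p a : nat) : prime p -> odd p -> ~~ (p %| a)%N ->
  square_mod p a -> padic_square p a.
Proof.
move=> pp podd pa sqa k; have p0 := prime_gt0 pp.
suff lift : forall n, exists x : int, ((p ^ n.+1)%N%:Z %| x ^+ 2 - a%:Z)%Z.
  case: k => [|k]; apply/square_modP; rewrite ?expn_gt0 ?p0 //.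
  by exists 0; rewrite expn0 dvd1z.
elim=> [|n [x /dvdzP[c hc]]].
  by rewrite expn1; apply/square_modP.
have px : ~~ (p%:Z %| x)%Z.
  apply: contra pa => px; rewrite -[a]/(`|a%:Z|%N) -[p]/(`|p%:Z|%N) -dvdzE.
  have -> : a%:Z = x ^+ 2 - (x ^+ 2 - a%:Z) by ring.
  by rewrite hc rpredB ?dvdz_exp // dvdz_mull // expnS PoszM dvdz_mulr.
have cop : coprimez (2 * x) p%:Z.
  rewrite coprimezE abszM absz_nat coprime_sym prime_coprime // Euclid_dvdM // negb_or.
  rewrite px andbT; apply/negP => /dvdn_leq => /(_ isT).
  by have := prime_gt1 pp; move: podd; case: (p) => [|[|[|]]].
have [u [v uv]] := Bezoutz (2 * x) p%:Z.
rewrite (eqP cop) in uv; set q := (p ^ n)%N%:Z.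
have EP : (p ^ n.+1)%N%:Z = p%:Z * q by rewrite expnS PoszM.
rewrite EP in hc; rewrite expnS PoszM EP.
exists (x - c * u * (p%:Z * q)); apply/dvdzP; exists (c * v + c ^+ 2 * u ^+ 2 * q).
have -> : a%:Z = x ^+ 2 - c * (u * (2 * x) + v * p%:Z) * (p%:Z * q).
  by rewrite uv mulr1 -hc; ring.
by ring.
Qed.

(** If 8 q divides x^2 - a and the quotient is odd, then replacing the odd
    number x by x + 4 q makes the quotient even. *)
Lemma padic_square_two (a : nat) : (a %% 8 = 1)%N -> padic_square 2 a.
Proof.
move=> a8 k.
suff lift : forall n, exists x : int, ((2 ^ n.+3)%N%:Z %| x ^+ 2 - a%:Z)%Z.
  apply: (@square_mod_dvd _ (2 ^ k.+3)); rewrite ?expn_gt0 // ?dvdn_exp2l //; last first.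
    by apply/square_modP; rewrite ?expn_gt0.
  by rewrite -addn3 leq_addr.
elim=> [|n [x /dvdzP[c hc]]].
  exists 1; rewrite (_ : a%:Z = (a %/ 8)%N%:Z * 8 + 1); last by lia.
  by apply/dvdzP; exists (- (a %/ 8)%N%:Z); rewrite -[(2 ^ 3)%N%:Z]/(8 : int); ring.
have E3 : (2 ^ n.+3)%N%:Z = 8 * (2 ^ n)%N%:Z by rewrite !expnS; lia.
have E4 : (2 ^ n.+4)%N%:Z = 16 * (2 ^ n)%N%:Z by rewrite !expnS; lia.
rewrite E3 in hc; rewrite E4; set q := (2 ^ n)%N%:Z in hc *.
have [y xE] : exists y, x = 2 * y + 1 by exists (x %/ 2)%Z; lia.
have [d [cE|cE]] : exists d, c = 2 * d \/ c = 2 * d + 1.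
  by exists (c %/ 2)%Z; lia.
  exists x; apply/dvdzP; exists d; rewrite hc cE; ring.
exists (x + 4 * q); apply/dvdzP; exists (d + y + 1 + q).
have -> : (x + 4 * q) ^+ 2 - a%:Z = (x ^+ 2 - a%:Z) + 8 * q * x + 16 * q * q by ring.
by rewrite hc cE xE; ring.
Qed.

Lemma square_mod_Fp (p a : nat) : prime p ->
  square_mod p a = [exists y : 'F_p, y ^+ 2 == a%:R].
Proof.
move=> pp; apply/existsP/existsP => [[x /eqP e]|[y /eqP e]].
  exists (x : nat)%:R; rewrite -natrX.
  by apply/eqP/val_inj; rewrite /= !val_Fp_nat.
have yp : (y < p)%N by have := ltn_ord y; rewrite [X in (_ < X)%N](Fp_cast pp).
exists (Ordinal yp); apply/eqP => /=.
have : (y : nat)%:R ^+ 2 = a%:R :> 'F_p by rewrite natr_Zp.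
by rewrite -natrX => /(congr1 val); rewrite /= !val_Fp_nat.
Qed.

(** The squares have index 2 in the cyclic group of units modulo p. *)
Lemma square_mod_trichotomy (p a b : nat) : prime p ->
  ~~ (p %| a)%N -> ~~ (p %| b)%N ->
  [\/ square_mod p a, square_mod p b | square_mod p (a * b)].
Proof.
move=> pp pa pb; rewrite !square_mod_Fp //.
have unitp c : ~~ (p %| c)%N -> (c%:R : 'F_p) \is a GRing.unit.
  by move=> pc; rewrite unitfE -(dvdn_pcharf (pchar_Fp pp)).
have /cyclicP[g gE] := field_unit_group_cyclic [set: {unit 'F_p}]%G.
have pow c (uc : (c%:R : 'F_p) \is a GRing.unit) : exists i, c%:R = (val g) ^+ i.
  have : FinRing.unit _ uc \in <[g]>%g by rewrite -gE inE.
  by case/cycleP => i /(congr1 val) /= e; exists i; rewrite e FinRing.val_unitX.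
have [i ai] := pow a (unitp a pa); have [j bj] := pow b (unitp b pb).
have even k : ~~ odd k -> [exists y : 'F_p, y ^+ 2 == val g ^+ k].
  move=> ek; apply/existsP; exists (val g ^+ k./2).
  by rewrite -exprM muln2 even_halfK.
rewrite natrM ai bj -exprD.
have [oi|ei] := boolP (odd i); last by constructor 1; apply: even.
have [oj|ej] := boolP (odd j); last by constructor 2; apply: even.
by constructor 3; apply: even; rewrite oddD oi oj.
Qed.

(** * Almost periodic sets of integers *)

Definition periodic (M : nat) (P : pred nat) : Prop := forall b, P (b + M)%N = P b.

Definition count_below (P : pred nat) (N : nat) : nat := (\sum_(b < N) P b)%N.

Lemma periodicM M P k b : periodic M P -> P (b + k * M)%N = P b.
Proof.
by move=> perP; elim: k => [|k IH]; rewrite ?addn0 // mulSn addnCA addnC perP IH.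
Qed.

Lemma periodic_mull M P k : periodic M P -> periodic (k * M) P.
Proof. by move=> perP b; rewrite periodicM. Qed.

Lemma count_belowD P N k : count_below P (N + k) =
  (count_below P N + count_below (fun b => P (N + b)%N) k)%N.
Proof. by rewrite /count_below big_split_ord. Qed.

Lemma count_below_le P N : (count_below P N <= N)%N.
Proof.
apply: (@leq_trans (\sum_(b < N) 1)); last by rewrite sum1_card card_ord.
by apply: leq_sum => i _; apply: leq_b1.
Qed.

Lemma leq_count_below (P Q : pred nat) N : (forall b, P b -> Q b) ->
  (count_below P N <= count_below Q N)%N.
Proof.
by move=> PQ; apply: leq_sum => i _; case: (boolP (P i)) => [/PQ->|].
Qed.

Lemma count_below_period M P k : periodic M P ->
  count_below P (k * M) = (k * count_below P M)%N.
Proof.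
move=> perP; elim: k => [|k IH]; first by rewrite /count_below big_ord0.
rewrite mulSn addnC count_belowD IH mulSn addnC; congr (_ + _)%N.
by apply: eq_bigr => b _; rewrite addnC periodicM.
Qed.

Lemma count_below_estimate M P N : (0 < M)%N -> periodic M P ->
  (M * count_below P N <= N * count_below P M + M * M)%N /\
  (N * count_below P M <= M * count_below P N + M * M)%N.
Proof.
move=> M0 perP; have le := count_below_le P M.
have ler := count_below_le (fun b => P (N %/ M * M + b)%N) (N %% M).
have lts : (N %% M < M)%N by rewrite ltn_mod.
have cE : count_below P N = (N %/ M * count_below P M
    + count_below (fun b => P (N %/ M * M + b)%N) (N %% M))%N.
  by rewrite [in LHS](divn_eq N M) count_belowD count_below_period.
have := divn_eq N M; rewrite cE; move: ler lts le.
move: (count_below (fun b => _) _) => r; move: (count_below P M) (N %/ M)%N (N %% M)%N.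
by move=> c q s rs sM cM ->; split; nia.
Qed.

(** The sets approximated by periodic sets for the upper density.  Unlike the
    sets that merely have a density, they are stable under intersection. *)
Definition almost_periodic (A : nat -> Prop) : Prop :=
  forall k, (0 < k)%N -> exists M (P E : pred nat),
  [/\ (0 < M)%N, periodic M P, periodic M E,
      (k * count_below E M <= M)%N
    & forall b, ~~ E b -> (A b <-> P b)].

Lemma eq_almost_periodic A B : (forall b, A b <-> B b) ->
  almost_periodic A -> almost_periodic B.
Proof.
move=> AB apA k k0; have [M [P [E [M0 perP perE cE EP]]]] := apA k k0.
by exists M, P, E; split=> // b /EP; rewrite AB.
Qed.

Lemma almost_periodicN A : almost_periodic A -> almost_periodic (fun b => ~ A b).
Proof.
move=> apA k k0; have [M [P [E [M0 perP perE cE EP]]]] := apA k k0.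
exists M, (predC P), E; split=> // [b|b /EP AP] /=; first by rewrite perP.
by rewrite AP; split=> /negP.
Qed.

Lemma almost_periodicI A B : almost_periodic A -> almost_periodic B ->
  almost_periodic (fun b => A b /\ B b).
Proof.
move=> apA apB k k0; have k20 : (0 < k.*2)%N by rewrite double_gt0.
have [M [P [E [M0 perP perE cE EP]]]] := apA _ k20.
have [N [Q [F [N0 perQ perF cF FQ]]]] := apB _ k20.
have perl G : periodic M G -> periodic (M * N) G.
  by rewrite mulnC; apply: periodic_mull.
have perr G : periodic N G -> periodic (M * N) G by apply: periodic_mull.
exists (M * N)%N, (predI P Q), (predU E F); split.
- by rewrite muln_gt0 M0.
- by move=> b /=; rewrite (perl _ perP) (perr _ perQ).
- by move=> b /=; rewrite (perl _ perE) (perr _ perF).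
- have : (count_below (predU E F) (M * N) <= count_below E (M * N) + count_below F (M * N))%N.
    rewrite /count_below -big_split; apply: leq_sum => i _ /=.
    by case: (E i); case: (F i).
  rewrite (count_below_period M perF) [in count_below E _]mulnC (count_below_period N perE).
  move: (count_below _ (_ * _)) (count_below E M) (count_below F N) cE cF => u v w.
  by rewrite -!muln2 => ? ? ?; nia.
by move=> b /=; rewrite negb_or => /andP[/EP-> /FQ->]; split=> /andP.
Qed.

Lemma almost_periodic_all (T : eqType) (ts : seq T) (A : T -> nat -> Prop) :
  {in ts, forall t, almost_periodic (A t)} ->
  almost_periodic (fun b => {in ts, forall t, A t b}).
Proof.
elim: ts => [|t ts IH] apA.
  move=> k k0; exists 1%N, predT, pred0; split=> //.
  by rewrite /count_below big1 ?muln0.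
have /IH apts : {in ts, forall t, almost_periodic (A t)}.
  by move=> u us; apply: apA; rewrite inE us orbT.
apply: eq_almost_periodic (almost_periodicI (apA t (mem_head _ _)) apts) => b.
split=> [[At Ats] u|Ats].
  by rewrite inE => /predU1P[->|/Ats].
by split=> [|u us]; apply: Ats; rewrite inE ?eqxx ?us ?orbT.
Qed.

Lemma almost_periodic_negligible (A : nat -> Prop) :
  (forall k, (0 < k)%N -> exists M (E : pred nat),
     [/\ (0 < M)%N, periodic M E, (k * count_below E M <= M)%N
       & forall b, A b -> E b]) -> almost_periodic A.
Proof.
move=> negl k k0; have [M [E [M0 perE cE AE]]] := negl k k0.
by exists M, pred0, E; split=> // b nE; split=> // /AE; rewrite (negPf nE).
Qed.

Definition initial_count (A : set nat) (N : nat) : nat := #|` fset_set (A `&` `[1%N, N])|.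

Lemma initial_countE (A : set nat) (N : nat) :
  initial_count A N = count_below (fun b => `[< A b.+1 >]) N.
Proof.
rewrite /initial_count (@card_fset_set_seq _ _ [seq b <- iota 1 N | `[< A b >]]).
- rewrite size_filter -[1%N]addn0 iotaDl count_map -sum1_count big_mkcond /=.
  rewrite /count_below -(big_mkord xpredT (fun b => nat_of_bool `[< A b.+1 >])).
  by rewrite /index_iota subn0; apply: eq_bigr => b _; rewrite add1n; case: ifP.
- by rewrite filter_uniq // iota_uniq.
move=> b; rewrite mem_filter mem_iota /= in_itv /= add1n ltnS.
split=> [[Ab bN]|/andP[/asboolP Ab bN]]; first by apply/andP; split; [apply/asboolP|].
by [].
Qed.

Lemma initial_count_bounds (A : set nat) (N : nat) :
  (initial_count A N <= count_below (fun b => `[< A b >]) N.+1 <= (initial_count A N).+1)%N.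
Proof.
have -> : count_below (fun b => `[< A b >]) N.+1 = (`[< A 0%N >] + initial_count A N)%N.
  by rewrite initial_countE -[N.+1]add1n count_belowD {1}/count_below big_ord1.
by rewrite leq_addl /= -[(initial_count A N).+1]add1n leq_add2r leq_b1.
Qed.

(** The proportion of elements of A up to N is within 2/k of c/M: 1/k comes from
    the exceptional set and 1/k from the incomplete periods. *)
Lemma almost_periodic_estimate (A : set nat) : almost_periodic A ->
  forall k, (0 < k)%N -> exists M c N0, (0 < M)%N /\ forall N, (N0 <= N)%N ->
    (k * M * initial_count A N <= N * (k * c) + 2 * (N * M))%N /\
    (N * (k * c) <= k * M * initial_count A N + 2 * (N * M))%N.
Proof.
move=> apA k k0; have [M [P [E [M0 perP perE cE EP]]]] := apA k k0.
exists M, (count_below P M), (k + 2 * k * M + 1)%N; split=> // N NN.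
have /andP[] := initial_count_bounds A N.
set a := initial_count A N; set T := count_below _ N.+1 => aT Ta.
have APb b : ~~ E b -> `[< A b >] = P b.
  by move=> /EP AP; apply/asboolP/idP => /AP.
have TP : (T <= count_below P N.+1 + count_below E N.+1)%N.
  rewrite /T /count_below -big_split; apply: leq_sum => b _ /=.
  have [_|/APb ->] := boolP (E b); first by rewrite addn1 (leq_trans (leq_b1 _)).
  by rewrite addn0.
have PT : (count_below P N.+1 <= T + count_below E N.+1)%N.
  rewrite /T /count_below -big_split; apply: leq_sum => b _ /=.
  have [_|/APb ->] := boolP (E b); first by rewrite addn1 (leq_trans (leq_b1 _)).
  by rewrite addn0.
have [P1 P2] := count_below_estimate N.+1 M0 perP.
have [E1 _] := count_below_estimate N.+1 M0 perE.
have cM := count_below_le P M.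
move: (count_below P M) (count_below P N.+1) (count_below E M) (count_below E N.+1)
  cE TP PT P1 P2 E1 cM => c p e q cE TP PT P1 P2 E1 cM.
have kq : (k * (M * q) <= N.+1 * M + k * (M * M))%N.
  apply: leq_trans (leq_mul (leqnn k) E1) _.
  by rewrite mulnDr leq_add2r mulnCA leq_mul2l cE orbT.
have NM : (k * M + 2 * k * (M * M) + M <= N * M)%N.
  by apply: leq_trans (leq_mul NN (leqnn M)); rewrite !mulnDl; lia.
have kP1 := leq_mul (leqnn k) P1; have kP2 := leq_mul (leqnn k) P2.
have kTP := leq_mul (leqnn (k * M)) TP; have kPT := leq_mul (leqnn (k * M)) PT.
have kcM := leq_mul (leqnn k) cM.
have kaT := leq_mul (leqnn (k * M)) aT; have kTa := leq_mul (leqnn (k * M)) Ta.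
by rewrite -mulnA; split; lia.
Qed.

(** By the estimate the proportions form a Cauchy sequence. *)
Lemma almost_periodic_density (R : realType) (A : set nat) : almost_periodic A ->
  exists d : R, has_asymptotic_density A d.
Proof.
move=> apA; apply/cvg_ex/cauchy_cvgP/cauchy_exP => _/posnumP[e].
have [k ke] : exists k, (0 < k)%N /\ 2 / k%:R < e%:num.
  exists (Num.bound (2 / e%:num)).+1; split=> //.
  rewrite ltr_pdivrMr ?ltr0n // mulrC -ltr_pdivrMr //.
  apply: lt_trans (archi_boundP _) _; first by rewrite divr_ge0.
  by rewrite ltr_nat.
have [k0 {}ke] := ke.
have [M [c [N0 [M0 est]]]] := almost_periodic_estimate apA k0.
exists (c%:R / M%:R); exists (N0.+1) => // N /= NN.
have [up low] := est N (ltnW NN).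
have NR : 0 < N%:R :> R by rewrite ltr0n (leq_trans _ NN).
have MR : 0 < M%:R :> R by rewrite ltr0n.
have kR : 0 < k%:R :> R by rewrite ltr0n.
rewrite /ball /= ; apply: le_lt_trans ke.
rewrite -[#|` _ |]/(initial_count A N).
have DR : 0 < k%:R * M%:R * N%:R :> R by rewrite !mulr_gt0.
rewrite -(ler_pM2r DR) -{1}[k%:R * _ * _]gtr0_norm // -normrM.
have -> : (c%:R / M%:R - (initial_count A N)%:R / N%:R) * (k%:R * M%:R * N%:R)
     = (N * (k * c))%:R - (k * M * initial_count A N)%:R :> R.
  rewrite !natrM; field; by rewrite !gt_eqF.
have -> : 2 / k%:R * (k%:R * M%:R * N%:R) = (2 * (N * M))%:R :> R.
  by rewrite !natrM; field; rewrite gt_eqF.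
by rewrite ler_distl -!natrD lerBlDr -!natrD !ler_nat low up.
Qed.

Lemma asymptotic_density_gt0 (R : realType) (A : set nat) (d : R) (Q b0 : nat) :
  (0 < Q)%N -> (forall b, b = b0 %[mod Q] -> A b) ->
  has_asymptotic_density A d -> 0 < d.
Proof.
move=> Q0 AQ dens; pose P b := b == b0 %[mod Q].
have perP : periodic Q P by move=> b; rewrite /P modnDr.
have cP : (0 < count_below P Q)%N.
  have b0Q : (b0 %% Q < Q)%N by rewrite ltn_mod.
  by rewrite /count_below (bigD1 (Ordinal b0Q)) //= /P modn_mod eqxx.
apply: lt_le_trans (_ : (Q.*2%:R)^-1 <= _).
  by rewrite invr_gt0 ltr0n double_gt0.
apply: (cvgr_to_ge dens); exists (2 * (Q * Q + Q)).+1%N => // N /= NN.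
have NR : 0 < N%:R :> R by rewrite ltr0n (leq_trans _ NN).
rewrite -[#|` _ |]/(initial_count A N) ler_pdivlMr // mulrC ler_pdivrMr ?ltr0n ?double_gt0 //.
rewrite -natrM ler_nat.
have /andP[_] := initial_count_bounds A N.
have [_] := count_below_estimate N.+1 Q0 perP.
have : (count_below P N.+1 <= count_below (fun b => `[< A b >]) N.+1)%N.
  by apply: leq_count_below => b /eqP/AQ Ab; apply/asboolP.
move: (count_below _ N.+1) (count_below _ N.+1) (count_below _ _) cP => u v w w0.
rewrite -muln2; nia.
Qed.

(** * Almost periodicity of solvability *)

Lemma periodic_square_mod m : periodic m (square_mod m).
Proof. by move=> b; apply: eq_square_mod; rewrite modnDr. Qed.

(** Dividing b by p^2 as long as possible reduces to b prime to p, where the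
    margin of 3 in the exponent leaves at least a congruence modulo p, and modulo
    8 when p = 2. *)
Lemma padic_square_lift (p n b : nat) : prime p -> ~~ (p ^ n %| b)%N ->
  square_mod (p ^ (n + 3)) b -> padic_square p b.
Proof.
move=> pp; have p0 := prime_gt0 pp; have p1 := prime_gt1 pp.
have pk0 k : (0 < p ^ k)%N by rewrite expn_gt0 p0.
elim/ltn_ind: n b => n IH b nb sqb.
have [pb|pb] := boolP (p %| b)%N; last first.
  have [podd|] := boolP (odd p).
    apply: padic_square_odd => //; apply: square_mod_dvd sqb => //.
    by rewrite -{1}(expn1 p) dvdn_exp2l // addn3.
  move=> peven; have p2 : p = 2 by case: (even_prime pp) => // podd; rewrite podd in peven.
  subst p; apply: padic_square_two.
  have : square_mod 8 b by apply: square_mod_dvd sqb => //; rewrite (@dvdn_exp2l 2 3) ?leq_addl.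
  move=> /existsP[x /eqP]; move: pb; rewrite dvdn2 negbK.
  have := odd_mod b (erefl : odd 8 = false).
  have : (b %% 8 < 8)%N by rewrite ltn_mod.
  move: (b %% 8)%N => c c8 <- codd; case: x => x /= x8.
  by do 8 (case: x x8 => [|x] x8; [by case: c c8 codd => [|[|[|[|[|[|[|[|]]]]]]]]|]).
have [x hx] := square_modP _ (pk0 _) sqb.
have bE : b%:Z = x ^+ 2 - (x ^+ 2 - b%:Z) by rewrite opprB addrC subrK.
have px : (p%:Z %| x)%Z.
  have : (p%:Z %| x ^+ 2)%Z.
    rewrite -(subrK b%:Z (x ^+ 2)) rpredD //.
    by apply: dvdz_trans hx; rewrite addn3 expnS PoszM dvdz_mulr.
  by rewrite !dvdzE abszX Euclid_dvdX // andbT.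
have [y xE] := dvdzP px.
have P2 : (p ^ 2)%N%:Z = p%:Z ^+ 2 by rewrite expnS expn1 PoszM expr2.
have p2b : (p ^ 2 %| b)%N.
  have : ((p ^ 2)%N%:Z %| b%:Z)%Z.
    rewrite bE rpredB //; first by rewrite P2 dvdz_exp2r.
    apply: dvdz_trans hx; rewrite dvdzE !absz_nat; apply: dvdn_exp2l.
    by rewrite addn3.
  by rewrite dvdzE !absz_nat.
have n2 : (2 < n)%N.
  rewrite ltnNge; apply: contra nb => n2.
  by apply: dvdn_trans p2b; apply: dvdn_exp2l.
have [c bc] := dvdnP p2b.
have nE : n = (n - 2 + 2)%N by rewrite subnK // ltnW.
have sqc : padic_square p c.
  apply: (IH (n - 2)%N); first by rewrite ltn_subrL (ltn_trans _ n2).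
    apply: contra nb => h; rewrite bc nE expnD.
    by rewrite dvdn_pmul2r // pk0.
  apply/square_modP => //; exists y.
  rewrite -(@dvdz_mul2r (p%:Z ^+ 2)) ?expf_neq0 -?lt0n //.
  have -> : (y ^+ 2 - c%:Z) * p%:Z ^+ 2 = x ^+ 2 - b%:Z.
    by rewrite xE bc PoszM P2; ring.
  by rewrite -P2 -PoszM -expnD addnAC -nE.
move=> k; have [z hz] := square_modP _ (pk0 k) (sqc k).
apply/square_modP => //; exists (p%:Z * z).
have -> : (p%:Z * z) ^+ 2 - b%:Z = (z ^+ 2 - c%:Z) * p%:Z ^+ 2.
  by rewrite bc PoszM P2; ring.
by rewrite dvdz_mulr.
Qed.

Lemma count_multiples m : (0 < m)%N -> count_below (fun b => m %| b)%N m = 1%N.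
Proof.
case: m => // m _; rewrite /count_below big_ord_recl dvdn0 big1 // => i _.
by rewrite gtnNdvd // /bump /= add1n.
Qed.

(** By [padic_square_lift] a congruence modulo p^(k+3) decides, except on the
    multiples of p^k, whose density is at most 1/k. *)
Lemma almost_periodic_padic_square p : prime p -> almost_periodic (padic_square p).
Proof.
move=> pp k k0; have p0 := prime_gt0 pp; have p1 := prime_gt1 pp.
have pk0 n : (0 < p ^ n)%N by rewrite expn_gt0 p0.
have perE : periodic (p ^ k) (fun b => p ^ k %| b)%N.
  by move=> b; rewrite dvdn_addl.
exists (p ^ (k + 3))%N, (square_mod (p ^ (k + 3))), (fun b => p ^ k %| b)%N; split=> //.
- exact: periodic_square_mod.
- by rewrite addnC expnD; apply: periodic_mull perE.
- rewrite addnC expnD (count_below_period _ perE) count_multiples // muln1 mulnC.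
  by rewrite leq_mul2l (ltnW (ltn_expl _ _)) ?orbT.
move=> b nb; split=> [sqb|]; first exact: sqb.
exact: padic_square_lift.
Qed.

(** Opposite numbers have the same square, so the residues from 0 to (p - 1)/2
    give all the squares. *)
Lemma count_square_mod p : odd p -> (count_below (square_mod p) p <= p./2.+1)%N.
Proof.
move=> podd; have p0 : (0 < p)%N by case: (p) podd.
rewrite /count_below -big_mkcond /= sum1_card.
pose g (x : 'I_(p./2.+1)) : 'I_p := Ordinal (ltn_pmod (x ^ 2) p0).
apply: leq_trans (_ : #|g @: [set: 'I_(p./2.+1)]%SET| <= _)%N; last first.
  by apply: leq_trans (leq_imset_card _ _) _; rewrite cardsT card_ord.
apply/subset_leq_card/fintype.subsetP => b /existsP[x /eqP e].
have [xs|xl] := leqP x p./2.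
  apply/imsetP; exists (Ordinal (xs : (x < p./2.+1)%N)); first by rewrite inE.
  by apply: val_inj; rewrite /= e modn_small.
have px : (p - x < p./2.+1)%N.
  by have := odd_double_half p; rewrite podd -addnn; have := ltn_ord x; lia.
apply/imsetP; exists (Ordinal px); first by rewrite inE.
apply: val_inj; rewrite /= -[LHS](modn_small (ltn_ord b)) -e.
have xp := ltnW (ltn_ord x).
have E : ((p - x) ^ 2 + (2 * x) * p = x ^ 2 + p * p)%N.
  move: (nat_of_ord x) xp => y yp; rewrite -{2 3 4}(subnKC yp) -!mulnn.
  by move: (p - y)%N => d; lia.
have := congr1 (fun n => n %% p)%N E; rewrite /= [X in (X %% _)%N = _]addnC modnMDl.
by rewrite [X in _ = (X %% _)%N]addnC modnMDl.
Qed.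

Lemma count_below_blocks F M k :
  count_below F (k * M) = (\sum_(j < k) count_below (fun r => F (j * M + r)%N) M)%N.
Proof.
elim: k => [|k IH]; first by rewrite /count_below !big_ord0.
by rewrite mulSn addnC count_belowD IH big_ord_recr.
Qed.

Lemma periodic_mod M P b : periodic M P -> P (b %% M)%N = P b.
Proof. by move=> perP; rewrite [in RHS](divn_eq b M) addnC periodicM. Qed.

Lemma count_below_progression (M p r : nat) (Q : pred nat) :
  (0 < p)%N -> coprime M p -> periodic p Q ->
  (\sum_(j < p) Q (j * M + r)%N)%N = count_below Q p.
Proof.
move=> p0 cop perQ; pose h (j : 'I_p) := Ordinal (ltn_pmod (j * M + r) p0).
have hinj : injective h.
  move=> i j /(congr1 val) /= /eqP e; apply: val_inj => /=.
  wlog ji : i j e / (j <= i)%N => [wl|].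
    case: (leqP j i) => [|/ltnW] le; first exact: wl.
    by apply/esym/wl => //; rewrite eq_sym.
  move: e; rewrite eqn_modDr eqn_mod_dvd ?leq_mul2r ?ji ?orbT // -mulnBl.
  rewrite Gauss_dvdl 1?coprime_sym // => d; apply/eqP; rewrite eqn_leq ji andbT.
  rewrite -subn_eq0; apply: contraTT d; rewrite -lt0n => d.
  by rewrite gtnNdvd // (leq_ltn_trans (leq_subr _ _)).
rewrite /count_below [RHS](reindex_inj hinj); apply: eq_bigr => j _.
by rewrite /= (periodic_mod _ perQ).
Qed.

(** The p lifts to the integers modulo p M of a residue modulo M have distinct
    residues modulo p. *)
Lemma count_below_coprime (M p : nat) (E Q : pred nat) :
  (0 < p)%N -> coprime M p -> periodic M E -> periodic p Q ->
  count_below (predI E Q) (p * M) = (count_below E M * count_below Q p)%N.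
Proof.
move=> p0 cop perE perQ; rewrite count_below_blocks exchange_big /=.
rewrite [X in _ = (X * _)%N]/count_below big_distrl /=; apply: eq_bigr => r _.
rewrite -(count_below_progression r p0 cop perQ) big_distrr; apply: eq_bigr => j _ /=.
by rewrite addnC periodicM // mulnb.
Qed.

(** The set has density 0.  Squares modulo an odd prime have density at most
    2/3, and conditions modulo different primes are independent, so j primes leave
    at most (2/3)^j. *)
Lemma almost_periodic_square_mod_infinite (A : nat -> Prop) :
  (forall N, exists p, [/\ prime p, (N < p)%N & forall b, A b -> square_mod p b]) ->
  almost_periodic A.
Proof.
move=> inf; apply: almost_periodic_negligible => k k0.
have sieve j : exists M (E : pred nat), [/\ (0 < M)%N, periodic M E,
    (3 ^ j * count_below E M <= 2 ^ j * M)%N & forall b, A b -> E b].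
  elim: j => [|j [M [E [M0 perE cE AE]]]].
    by exists 1%N, predT; split=> //; rewrite /count_below big_ord1.
  have [p [pp Mp Ap]] := inf (M + 2)%N.
  have podd : odd p by case: (even_prime pp) => //; lia.
  have p0 := prime_gt0 pp.
  have cop : coprime M p.
    by rewrite coprime_sym prime_coprime // gtnNdvd //; lia.
  exists (p * M)%N, (predI E (square_mod p)); split.
  - by rewrite muln_gt0 p0.
  - move=> b /=; rewrite (periodic_mull _ perE) mulnC.
    by rewrite (periodic_mull _ (@periodic_square_mod p)).
  - rewrite (count_below_coprime p0 cop perE (@periodic_square_mod p)) !expnS.
    have := count_square_mod podd; have := odd_double_half p; rewrite podd -muln2.
    have p3 : (3 <= p)%N by lia.
    move: (count_below _ M) (count_below _ p) (3 ^ j)%N (2 ^ j)%N (p./2) cE => e c u v h.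
    move=> ueM hp ch; have c3 : (3 * c <= 2 * p)%N by lia.
    by have := leq_mul ueM c3; nia.
  by move=> b Ab /=; rewrite AE ?Ap.
(* 2k primes are enough, because k 4^k <= 9^k. *)
have [M [E [M0 perE cE AE]]] := sieve (2 * k)%N; exists M, E; split=> //.
have pow : (k * 2 ^ (2 * k) <= 3 ^ (2 * k))%N.
  rewrite !expnM; have e9 : (3 ^ 2)%N = 9%N by []. 
  have e4 : (2 ^ 2)%N = 4%N by [].
  rewrite e9 e4; elim: (k) => // n IHn; rewrite !expnS.
  case: n IHn => // n; move: (4 ^ n.+1)%N (9 ^ n.+1)%N => x y IHn.
  by nia.
have : (2 ^ (2 * k) * (k * count_below E M) <= 2 ^ (2 * k) * M)%N.
  by apply: leq_trans cE; rewrite mulnCA mulnA leq_mul2r pow orbT.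
by rewrite leq_pmul2l // expn_gt0.
Qed.

(** The condition is that b be a p-adic square at each bad prime, that is, each
    prime where no element of s is one.  Finitely many bad primes give a
    finite intersection of almost periodic sets; infinitely many give a set of
    density 0. *)
Lemma almost_periodic_locally_solvable (s : seq nat) :
  almost_periodic (fun b => locally_solvable (quadratics (b :: s))).
Proof.
pose bad p := prime p /\ forall a, a \in s -> ~ padic_square p a.
have solE b : locally_solvable (quadratics (b :: s)) <->
    (forall p, bad p -> padic_square p b).
  rewrite locally_solvable_quadratics; split=> sol p.
    case=> pp bp; have [a] := sol p pp.
    by rewrite inE => /predU1P[->|/bp].
  move=> pp; have [[a sa sqa]|nob] := pselect (exists2 a, a \in s & padic_square p a).
    by exists a; rewrite // inE sa orbT.
  exists b; rewrite ?mem_head //; apply: sol; split=> // a sa sqa.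
  by apply: nob; exists a.
have [[N badN]|inf] := pselect (exists N, forall p, bad p -> (p <= N)%N).
  pose ps := [seq p <- iota 0 N.+1 | `[< bad p >]].
  have psE p : p \in ps <-> bad p.
    rewrite mem_filter mem_iota /= add0n ltnS; split=> [/andP[/asboolP]//|bp].
    by rewrite badN // andbT; apply/asboolP.
  apply: eq_almost_periodic (_ : almost_periodic
     (fun b => {in ps, forall p, padic_square p b})) => [b|].
    by rewrite solE; split=> sq p /psE; apply: sq.
  by apply: almost_periodic_all => p /psE[pp _]; apply: almost_periodic_padic_square.
apply: almost_periodic_square_mod_infinite => N.
apply: contrapT => no; apply: inf; exists N => p bp; rewrite leqNgt; apply/negP => Np.
apply: no; exists p; split=> //; first by case: bp.
by move=> b /solE/(_ p bp)/(_ 1%N); rewrite expn1.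
Qed.

Lemma almost_periodic_cst (Q : Prop) : almost_periodic (fun _ => Q).
Proof.
move=> k k0; exists 1%N, (fun _ => `[< Q >]), pred0; split=> // [|b _].
  by rewrite /count_below big1 ?muln0.
by split=> [/asboolP|/asboolP].
Qed.

(** Removing b leaves a condition without b; removing y leaves the condition of
    [almost_periodic_locally_solvable] for the rest of s. *)
Lemma almost_periodic_minimally_intersective (R : realType) (s : seq nat) :
  (0 < size s)%N ->
  almost_periodic (fun b => minimally_intersective R (quadratics (b :: s))).
Proof.
move=> s0.
apply: eq_almost_periodic (_ : almost_periodic (fun b =>
   (locally_solvable (quadratics (b :: s)) /\ ~ locally_solvable (quadratics s)) /\
   {in s, forall y, ~ locally_solvable (quadratics (b :: rem y s))})) => [b|].
  have remE y : y \in s -> quadratics (rem y (b :: s)) = quadratics (b :: rem y s).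
    move=> ys /=; case: eqP => [->|//].
    by rewrite (quadratics_rem ys) /quadratics big_cons.
  rewrite minimally_intersective_quadratics ?ltnS //; split.
    move=> [[sol nos] norem]; split=> // y; rewrite inE.
    have [->|ne] := eqVneq y b => [_|ys]; first by rewrite /= eqxx.
    by rewrite remE //; apply: norem.
  move=> [sol norem]; split=> [|y ys]; last first.
    by rewrite -remE //; apply: norem; rewrite inE ys orbT.
  by split=> //; have := norem b (mem_head _ _); rewrite /= eqxx.
apply: almost_periodicI; last first.
  by apply: almost_periodic_all => y _; apply/almost_periodicN/almost_periodic_locally_solvable.
apply: almost_periodicI; first exact: almost_periodic_locally_solvable.
exact: almost_periodic_cst.
Qed.

(** * The coefficients *)

(** If y^2 = -1 in the field with p = 4 j + 3 elements, then y ^ p = - y. *)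
Lemma not_square_mod_opp1 (p z : nat) : prime p -> (p %% 4 = 3)%N ->
  (p %| z.+1)%N -> ~~ square_mod p z.
Proof.
move=> pp p4 pz; rewrite square_mod_Fp //; apply/negP => /existsP[y /eqP y2].
have zE : z%:R = -1 :> 'F_p.
  apply/eqP; rewrite -subr_eq0 opprK natr1.
  by rewrite -(dvdn_pcharf (pchar_Fp pp)).
have pE : p = (2 * (2 * (p %/ 4)).+1).+1 by rewrite {1}(divn_eq p 4) p4; lia.
have : y ^+ (2 * (2 * (p %/ 4)).+1).+1 = y.
  by rewrite -pE; have := expf_card y; rewrite card_Fp.
rewrite exprS exprM y2 zE exprS exprM sqrrN expr1n expr1n mulr1 mulrN1 => /eqP.
rewrite eq_sym -subr_eq0 opprK -mulr2n -mulr_natl mulf_eq0 => /orP[].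
  rewrite -(dvdn_pcharf (pchar_Fp pp)) => /dvdn_leq => /(_ isT).
  by have := prime_gt1 pp; move: p4; case: (p) => [|[|[|]]].
move/eqP => y0; move: y2; rewrite y0 zE expr0n /= => /eqP.
by rewrite eq_sym oppr_eq0 oner_eq0.
Qed.

(** A product of numbers that are 1 modulo 4 is again 1 modulo 4. *)
Lemma prime_3mod4_dvd m : (m %% 4 = 3)%N ->
  exists p, [/\ prime p, (p %% 4 = 3)%N & (p %| m)%N].
Proof.
elim/ltn_ind: m => m IH m4.
have m1 : (1 < m)%N by case: m m4 {IH} => [|[]].
have pp := pdiv_prime m1; have pm := pdiv_dvd m; move: (pdiv m) pp pm => p pp pm.
have [qm mE] : exists q, m = (q * p)%N by apply/dvdnP.
have p1 := prime_gt1 pp.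
have [p4|p4] := eqVneq (p %% 4)%N 3%N; first by exists p.
have mm : (((qm %% 4) * (p %% 4)) %% 4 = 3)%N by rewrite modnMm -mE.
have q4 : (qm %% 4 = 3)%N.
  have : (p %% 4 < 4)%N by rewrite ltn_mod.
  have : (qm %% 4 < 4)%N by rewrite ltn_mod.
  move: (p %% 4)%N (qm %% 4)%N mm p4 => x y.
  by case: x => [|[|[|[|x]]]]; case: y => [|[|[|[|y]]]].
have qm0 : (0 < qm)%N by case: (qm) q4.
have [||p' [pp' p'4 p'q]] := IH qm => //.
  by rewrite mE ltn_Pmulr.
by exists p'; split=> //; rewrite mE dvdn_mulr.
Qed.

Lemma prime_3mod4_above N : exists p, [/\ prime p, (p %% 4 = 3)%N & (N < p)%N].
Proof.
have N0 := fact_gt0 N.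
have [|p [pp p4 pN]] := @prime_3mod4_dvd (4 * N`!).-1; first by lia.
exists p; split=> //; rewrite ltnNge; apply/negP => pleN.
have pN' : (p %| 4 * N`!)%N by rewrite dvdn_mull // dvdn_fact // prime_gt0.
have : (p %| 1)%N.
  by rewrite -(dvdn_addr _ pN) addn1 prednK // muln_gt0.
by rewrite dvdn1 => /eqP p1; rewrite p1 in pp.
Qed.

Lemma primes_3mod4 t : exists ps : seq nat, [/\ size ps = t, uniq ps
  & {in ps, forall p, [/\ prime p, (p %% 4 = 3)%N & (7 < p)%N]}].
Proof.
elim: t => [|t [ps [szps ups psP]]]; first by exists [::].
have [p [pp p4 pl]] := prime_3mod4_above (7 + \sum_(q <- ps) q).
exists (p :: ps); split=> /=; first by rewrite szps.
- rewrite ups andbT; apply/negP => pps.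
  by move: pl; rewrite ltnNge (big_rem _ pps) /= addnCA leq_addr.
- move=> q; rewrite inE => /predU1P[->|/psP//].
  by split=> //; apply: leq_ltn_trans pl; apply: leq_addr.
Qed.

Lemma mod_mul_sqr1 (P u d : nat) :
  (P * (u ^ 2 + 1) %% d = (P %% d) * ((u %% d) ^ 2 + 1) %% d)%N.
Proof.
by apply/esym; rewrite modnMml -modnMmr -(modnDml ((u %% d) ^ 2)) modnXm modnDml modnMmr.
Qed.

Lemma chinese_remainder m1 m2 r1 r2 : coprime m1 m2 ->
  exists x, (x = r1 %[mod m1])%N /\ (x = r2 %[mod m2])%N.
Proof.
move=> cop; exists (chinese m1 m2 r1 r2).
by rewrite chinese_modl // chinese_modr.
Qed.

Lemma eqn_mod_dvdl d m x y : (d %| m)%N -> (x = y %[mod m])%N -> (x = y %[mod d])%N.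
Proof. by move=> dm e; rewrite -(modn_dvdm x dm) e modn_dvdm. Qed.

(** The factor u^2 + 1 takes both quadratic characters modulo 5 and modulo 7,
    both values 1 and 2 modulo 3, and, for u even, both values 1 and 5 modulo 8.
    Choosing each of them according to the residue of P makes a a square modulo 3,
    a nonsquare modulo 5 and 7, and 1 or -1 modulo 8. *)
Lemma adjust_residues P :
  ~~ (2 %| P)%N -> ~~ (3 %| P)%N -> ~~ (5 %| P)%N -> ~~ (7 %| P)%N -> exists u,
  let a := (P * (u ^ 2 + 1))%N in
  [/\ ~~ odd u, a %% 3 = 1, (a %% 5 = 2 \/ a %% 5 = 3),
      (a %% 7 = 3 \/ a %% 7 = 5 \/ a %% 7 = 6)
    & (a %% 8 = 1 \/ a %% 8 = 7)]%N.
Proof.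
move=> P2 P3 P5 P7.
(* i, j, k, l are the residues of u modulo 3, 5, 7, 8. *)
pose i := (if P %% 3 == 1 then 0 else 1)%N.
pose j := (if (P %% 5 == 1) || (P %% 5 == 4) then 1 else 0)%N.
pose k := (if [|| P %% 7 == 1, P %% 7 == 2 | P %% 7 == 4] then 2 else 0)%N.
pose l := (if (P %% 8 == 1) || (P %% 8 == 7) then 0 else 2)%N.
have [v [v3 v5]] := @chinese_remainder 3 5 i j isT.
have [w [w7 w8]] := @chinese_remainder 7 8 k l isT.
have [u [uv uw]] := @chinese_remainder (3 * 5) (7 * 8) v w isT.
have ui := eqn_mod_dvdl (dvdn_mulr _ (dvdnn _)) uv; rewrite v3 in ui.
have uj := eqn_mod_dvdl (dvdn_mull _ (dvdnn _)) uv; rewrite v5 in uj.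
have uk := eqn_mod_dvdl (dvdn_mulr _ (dvdnn _)) uw; rewrite w7 in uk.
have ul := eqn_mod_dvdl (dvdn_mull _ (dvdnn _)) uw; rewrite w8 in ul.
exists u => a; rewrite {}/a (mod_mul_sqr1 P u 3) (mod_mul_sqr1 P u 5) (mod_mul_sqr1 P u 7).
rewrite (mod_mul_sqr1 P u 8) ui uj uk ul.
split.
- by have := congr1 odd ul; rewrite !odd_mod // => ->; rewrite /l; case: ifP.
- rewrite /i; move: P3; rewrite /dvdn; move: (ltn_pmod P (isT : 0 < 3)%N).
  by case: (P %% 3)%N => [|[|[|r]]].
- rewrite /j; move: P5; rewrite /dvdn; move: (ltn_pmod P (isT : 0 < 5)%N).
  by case: (P %% 5)%N => [|[|[|[|[|r]]]]] //= _ _; [left|left|right|right].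
- rewrite /k; move: P7; rewrite /dvdn; move: (ltn_pmod P (isT : 0 < 7)%N).
  case: (P %% 7)%N => [|[|[|[|[|[|[|r]]]]]]] //= _ _;
    by first [by left | by (right; left) | by (right; right)].
- have podd : odd (P %% 8) by move: P2; rewrite odd_mod // dvdn2 negbK.
  rewrite /l; move: podd; move: (ltn_pmod P (isT : 0 < 8)%N).
  case: (P %% 8)%N => [|[|[|[|[|[|[|[|r]]]]]]]] //= _ _;
    by first [by left | by right].
Qed.

(** A p-adic square has even valuation. *)
Lemma not_square_mod_exact (p a : nat) : prime p -> (p %| a)%N -> ~~ (p ^ 2 %| a)%N ->
  ~~ square_mod (p ^ 2) a.
Proof.
move=> pp pa p2a; apply: contra p2a => /existsP[x /eqP e].
have px : (p %| x ^ 2)%N.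
  rewrite /dvdn -(modn_dvdm _ (_ : p %| p ^ 2)%N) ?e ?modn_dvdm //; by rewrite dvdn_exp.
have p2x : (p ^ 2 %| x ^ 2)%N.
  by rewrite dvdn_exp2r //; move: px; rewrite Euclid_dvdX // andbT.
by rewrite /dvdn -e.
Qed.

(** A modulus for which y is the only square witnesses that y cannot be
    removed. *)
Lemma locally_unsolvable_rem (p k : nat) (s : seq nat) (y : nat) : prime p ->
  y \in s -> square_mod (p ^ k) y -> count (square_mod (p ^ k)) s = 1%N ->
  ~ locally_solvable (quadratics (rem y s)).
Proof.
move=> pp ys sqy c1 /locally_solvable_quadratics/(_ p pp)[a ar sqa].
have : (0 < count (square_mod (p ^ k)) (rem y s))%N.
  by rewrite -has_count; apply/hasP; exists a.
by rewrite count_rem ys sqy c1.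
Qed.

Lemma square_mod_residue m r a : (a %% m = r)%N -> square_mod m a = square_mod m r.
Proof. by move=> <-; apply: eq_square_mod; rewrite modn_mod. Qed.

Lemma square_mod_3_1 : square_mod 3 1. Proof. exact: (@square_mod_sqr 3 1). Qed.
Lemma square_mod_3_2 : square_mod 3 2 = false.
Proof. by apply/negbTE/existsP => -[[[|[|[|x]]] lx]]. Qed.
Lemma square_mod_5 : [/\ square_mod 5 2 = false, square_mod 5 3 = false & square_mod 5 4].
Proof.
split; last exact: (@square_mod_sqr 5 2).
all: by apply/negbTE/existsP => -[[[|[|[|[|[|x]]]]] lx]].
Qed.
Lemma square_mod_7 : [/\ square_mod 7 3 = false, square_mod 7 5 = false,
  square_mod 7 6 = false & [/\ square_mod 7 1, square_mod 7 2 & square_mod 7 4]].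
Proof.
split; last first.
  split; [exact: (@square_mod_sqr 7 1)| |exact: (@square_mod_sqr 7 2)].
  by rewrite -(@square_mod_residue 7 2 (3 ^ 2)) // square_mod_sqr.
all: by apply/negbTE/existsP => -[[[|[|[|[|[|[|[|x]]]]]]] lx]].
Qed.

Lemma dvdn_prod_primes (p : nat) (ps : seq nat) : prime p ->
  {in ps, forall q, prime q} -> (p %| \prod_(q <- ps) q)%N = (p \in ps).
Proof.
move=> pp psP; rewrite Euclid_dvd_prod // big_has -has_pred1.
by apply: eq_in_has => q qps; rewrite /= eq_sym dvdn_prime2 // psP.
Qed.

(** At p the number e is a square, while at the other primes of ps, which are 3
    modulo 4, and modulo 3, 5 and 7, it is a nonsquare: -1 is a nonsquare modulo
    primes that are 3 modulo 4, and 2 is one modulo 5. *)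
Definition separates (ps : seq nat) (p e : nat) : Prop :=
  [/\ e = 1 %[mod p], {in ps, forall q, q != p -> q %| e.+1},
      e %% 3 = 2, e %% 5 = 2 & e %% 7 = 6]%N.

(** The factor 420^2 in c is a multiple of 3, 5, 7 and 8, so c is -1 modulo each
    of them: a nonsquare modulo 3 and 7, a square modulo 5, and a c is 1 modulo 8
    when a is -1 modulo 8.  Since a c + a = (420 a)^2, a is a square modulo
    every divisor of c. *)
Lemma minimal_configuration (ps : seq nat) (u : nat) (x : nat -> nat) :
  let a := (\prod_(p <- ps) p * (u ^ 2 + 1))%N in
  let c := (420 * (420 * a)).-1%N in
  let s := [seq x p | p <- ps] ++ [:: a; c; (a * c)%N] in
  uniq ps ->
  {in ps, forall p, [/\ prime p, (p %% 4 = 3)%N & (7 < p)%N]} ->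
  ~~ odd u ->
  [/\ a %% 3 = 1, (a %% 5 = 2 \/ a %% 5 = 3),
      (a %% 7 = 3 \/ a %% 7 = 5 \/ a %% 7 = 6)
    & (a %% 8 = 1 \/ a %% 8 = 7)]%N ->
  {in ps, forall p, separates ps p (x p)} ->
  locally_solvable (quadratics s) /\
  {in s, forall y, ~ locally_solvable (quadratics (rem y s))}.
Proof.
move=> a c s ups psP uev [a3 a5 a7 a8] xP.
have psprime : {in ps, forall p, prime p} by move=> p /psP[].
have P0 : (0 < \prod_(p <- ps) p)%N.
  by rewrite big_seq prodn_cond_gt0 // => p /psP[/prime_gt0].
have a0 : (0 < a)%N by rewrite muln_gt0 P0 addn1.
have cS : c.+1 = (420 * (420 * a))%N by rewrite prednK // (muln_gt0 420) (muln_gt0 420) a0.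
have [c3 c5 c7 c8] : [/\ c %% 3 = 2, c %% 5 = 4, c %% 7 = 6 & c %% 8 = 7]%N.
  by move: (c) (a) cS => c0 b h; clear -h; split; lia.
have ac m : ((a * c) %% m = ((a %% m) * (c %% m)) %% m)%N by rewrite modnMm.
have [as_ cs acs] : [/\ a \in s, c \in s & (a * c)%N \in s].
  by rewrite !mem_cat !inE !eqxx !orbT.
have xs p : p \in ps -> x p \in s by move=> pps; rewrite mem_cat (map_f x pps).
have pa p : p \in ps -> (p %| a)%N by move=> pps; rewrite /a (big_rem _ pps) /= -mulnA dvdn_mulr.
have pc p : (p %| a)%N -> (p %| c.+1)%N.
  by move=> pda; rewrite cS; apply/dvdn_mull/dvdn_mull.
have p1n p : prime p -> (p %| c.+1)%N -> ~~ (p %| c)%N.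
  move=> pp pc1; apply/negP => pc0; have : (p %| 1)%N by rewrite -(dvdn_addr _ pc0) addn1.
  by rewrite dvdn1 => /eqP e; rewrite e in pp.
have podd p : prime p -> (p %% 4 = 3)%N -> odd p.
  by move=> _ p4; have := odd_mod p (erefl : odd 4 = false); rewrite p4.
split.
  apply/locally_solvable_quadratics => p pp.
  have [pps|pps] := boolP (p \in ps).
    have [x1 _ _ _ _] := xP p pps; have [_ p4 _] := psP p pps.
    exists (x p); first exact: xs.
    apply: padic_square_odd => //; first exact: podd.
      by rewrite /dvdn x1 modn_small ?prime_gt1.
    by rewrite (eq_square_mod x1) (@square_mod_sqr _ 1) ?prime_gt0.
  case: (even_prime pp) => [->|oddp].
    case: a8 => a8; first by exists a => //; apply: padic_square_two.
    by exists (a * c)%N => //; apply: padic_square_two; rewrite ac a8 c8.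
  have [pda|pda] := boolP (p %| a)%N.
    have pw : (p %| u ^ 2 + 1)%N.
      move: pda; rewrite /a Euclid_dvdM // => /orP[|//].
      by rewrite dvdn_prod_primes // (negPf pps).
    have pc1 := pc p pda.
    exists c => //; apply: padic_square_odd => //; first exact: p1n.
    apply/square_modP; first exact: prime_gt0.
    exists u%:Z; have -> : u%:Z ^+ 2 - c%:Z = (u ^ 2 + 1)%N%:Z - c.+1%:Z.
      by rewrite PoszD -(addn1 c) PoszD -mulnn PoszM expr2; ring.
    by rewrite rpredB // dvdzE !absz_nat.
  have [pdc|pdc] := boolP (p %| c)%N.
    exists a => //; apply: padic_square_odd => //.
    apply/square_modP; first exact: prime_gt0.
    have cZ : c%:Z = 420 * (420 * a%:Z) - 1.
      by move: (c) (a) cS => c0 b h; clear -h; lia.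
    exists (420 * a%:Z); have -> : (420 * a%:Z) ^+ 2 - a%:Z = a%:Z * c%:Z.
      by rewrite cZ; ring.
    by rewrite dvdz_mull // dvdzE !absz_nat.
  by case: (square_mod_trichotomy pp pda pdc) => sq;
    [exists a|exists c|exists (a * c)%N] => //; apply: padic_square_odd => //;
    rewrite Euclid_dvdM // negb_or pda.
have none m r : {in ps, forall p, x p %% m = r}%N -> square_mod m r = false ->
    count (square_mod m) [seq x p | p <- ps] = 0%N.
  move=> xr nr; rewrite count_map; apply/eqP; rewrite -leqn0 leqNgt -has_count.
  by apply/hasP => -[p /xr/square_mod_residue/= ->]; rewrite nr.
have [s52 s53 s54] := square_mod_5; have [s73 s75 s76 [s71 s72 s74]] := square_mod_7.
move=> y; rewrite mem_cat !inE => /orP[/mapP[p pps ->]|/or3P[]/eqP ->].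
- have [pp p4 p7] := psP p pps; have [x1 xq _ _ _] := xP p pps.
  have p0 := prime_gt0 pp.
  have sub z : square_mod (p ^ 2) z -> square_mod p z.
    by apply: square_mod_dvd; rewrite ?expn_gt0 ?p0 // dvdn_exp.
  apply: (@locally_unsolvable_rem p 2) => //; first exact: xs.
    apply: padic_square_odd => //; first exact: podd.
      by rewrite /dvdn x1 modn_small ?prime_gt1.
    by rewrite (eq_square_mod x1) (@square_mod_sqr _ 1) ?prime_gt0.
  have p2a : ~~ (p ^ 2 %| a)%N.
    apply/negP; rewrite /a (big_rem _ pps) /= -mulnA dvdn_pmul2l // Euclid_dvdM //.
    case/orP.
      rewrite dvdn_prod_primes ?mem_rem_uniqF // => q /mem_rem.
      exact: psprime.
    rewrite addn1 => /(not_square_mod_opp1 pp p4).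
    by rewrite square_mod_sqr.
  have pda := pa p pps; have pc1 := pc p pda.
  rewrite count_cat /= (negPf (not_square_mod_exact pp pda p2a)).
  rewrite (negPf (contra (@sub c) (not_square_mod_opp1 pp p4 pc1))).
  have p2ac : ~~ (p ^ 2 %| a * c)%N.
    by rewrite Gauss_dvdl // coprimeXl // prime_coprime // p1n.
  rewrite (negPf (not_square_mod_exact pp (dvdn_mulr c pda) p2ac)) !addn0.
  rewrite count_map (eq_in_count (_ : {in ps, preim x (square_mod (p ^ 2)) =1 pred1 p})).
    by rewrite (count_uniq_mem _ ups) pps.
  move=> q qps /=; have [->|qp] := eqVneq q p.
    apply: padic_square_odd => //; first exact: podd.
      by rewrite /dvdn x1 modn_small ?prime_gt1.
    by rewrite (eq_square_mod x1) (@square_mod_sqr _ 1) ?prime_gt0.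
  have [_ xqq _ _ _] := xP q qps.
  apply/negbTE/(contra (@sub _))/(not_square_mod_opp1 pp p4)/xqq => //.
  by rewrite eq_sym.
- apply: (@locally_unsolvable_rem 3 1) => //; rewrite expn1.
    by rewrite (square_mod_residue a3) square_mod_3_1.
  rewrite count_cat (none 3%N 2%N) ?square_mod_3_2 //=; last by move=> p /xP[].
  rewrite (square_mod_residue a3) (square_mod_residue c3).
  by rewrite (@square_mod_residue 3 2 (a * c)) ?ac ?a3 ?c3 // square_mod_3_2 square_mod_3_1.
- apply: (@locally_unsolvable_rem 5 1) => //; rewrite expn1.
    by rewrite (square_mod_residue c5).
  rewrite count_cat (none 5%N 2%N) //=; last by move=> p /xP[].
  rewrite (square_mod_residue c5) s54; case: a5 => a5.
    rewrite (square_mod_residue a5) s52.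
    by rewrite (@square_mod_residue 5 3 (a * c)) ?s53 // ac a5 c5.
  rewrite (square_mod_residue a5) s53.
  by rewrite (@square_mod_residue 5 2 (a * c)) ?s52 // ac a5 c5.
- have acsq : square_mod 7 (a * c).
    case: a7 => [a7|[a7|a7]].
    + by rewrite (@square_mod_residue 7 4 (a * c)) // ac a7 c7.
    + by rewrite (@square_mod_residue 7 2 (a * c)) // ac a7 c7.
    + by rewrite (@square_mod_residue 7 1 (a * c)) // ac a7 c7.
  apply: (@locally_unsolvable_rem 7 1) => //; rewrite expn1 //.
  rewrite count_cat (none 7%N 6%N) //=; last by move=> p /xP[].
  rewrite (square_mod_residue c7) s76 acsq.
  by case: a7 => [|[|]] /square_mod_residue ->; rewrite ?s73 ?s75 ?s76.
Qed.

Lemma eq_separates (ps : seq nat) (p e b : nat) : p \in ps ->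
  b = e %[mod 105 * \prod_(q <- ps) q] -> separates ps p e -> separates ps p b.
Proof.
move=> pps be [e1 eq e3 e5 e7].
have dvd q : q \in ps -> (q %| 105 * \prod_(q <- ps) q)%N.
  by move=> qps; rewrite (big_rem _ qps) /= dvdn_mull // dvdn_mulr.
have [d3 d5 d7] : [/\ 3 %| 105 * \prod_(q <- ps) q,
    5 %| 105 * \prod_(q <- ps) q & 7 %| 105 * \prod_(q <- ps) q]%N.
  by split; apply: dvdn_mulr.
split; rewrite ?(eqn_mod_dvdl _ be) //; first exact: dvd.
move=> q qps qp; have := eq q qps qp.
by rewrite /dvdn -addn1 -modnDml -(eqn_mod_dvdl (dvd q qps) be) modnDml addn1.
Qed.

Lemma separates_exists (ps : seq nat) (p : nat) : uniq ps ->
  {in ps, forall q, prime q /\ (7 < q)%N} -> p \in ps -> exists e, separates ps p e.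
Proof.
move=> ups psP pps; have psprime q : q \in ps -> prime q by case/psP.
have small r : prime r -> (r <= 7)%N -> r \notin ps.
  by move=> _ r7; apply/negP => /psP[_]; rewrite ltnNge r7.
set W := (\prod_(q <- rem p ps) q)%N.
have remprime : {in rem p ps, forall q, prime q}.
  by move=> q /mem_rem /psprime.
have W0 : (0 < W)%N.
  by rewrite /W big_seq prodn_cond_gt0 // => q /remprime/prime_gt0.
have coW r : prime r -> (r <= 7)%N -> coprime r W.
  move=> rp r7; rewrite prime_coprime // dvdn_prod_primes //.
  by apply: contra (small r rp r7) => /mem_rem.
have pp := psprime p pps; have [_ p7] := psP p pps.
have cop r : prime r -> (r <= 7)%N -> coprime p r.
  move=> rp r7; rewrite prime_coprime // dvdn_prime2 //.
  by apply/eqP => e; rewrite e ltnNge r7 in p7.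
(* Modulo W and 21 the number e is -1. *)
have [|v [v5 vW]] := @chinese_remainder 5 (3 * 7 * W) 2 (3 * 7 * W).-1.
  by rewrite !coprimeMr coW.
have [|e [e1 ev]] := @chinese_remainder p (5 * (3 * 7 * W)) 1 v.
  rewrite !coprimeMr (cop 5) // (cop 3) // (cop 7) // prime_coprime // dvdn_prod_primes //.
  by rewrite mem_rem_uniqF.
have eW := eqn_mod_dvdl (dvdn_mull _ (dvdnn _)) ev; rewrite vW in eW.
have opp q : (q %| 3 * 7 * W)%N -> (q %| e.+1)%N.
  move=> qW; have := eqn_mod_dvdl qW eW => eq.
  rewrite /dvdn -addn1 -modnDml eq modnDml addn1 prednK ?muln_gt0 ?W0 //.
have e3 : (3 %| e.+1)%N by apply: opp; rewrite -mulnA dvdn_mulr.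
have e7 : (7 %| e.+1)%N by apply: opp; rewrite dvdn_mulr // dvdn_mull.
have e5 : (e = 2 %[mod 5])%N by rewrite (eqn_mod_dvdl (dvdn_mulr _ (dvdnn _)) ev).
exists e; split; [exact: e1| |by clear -e3; lia|exact: e5|by clear -e7; lia].
move=> q qps qp; apply/opp/dvdn_mull.
by rewrite dvdn_prod_primes ?mem_rem_uniq ?inE ?qp //; apply: psprime.
Qed.

Lemma quadratic_product_nth (m : nat) (s : seq nat) : size s = m ->
  quadratic_product (fun i : 'I_m => nth 0%N s i) = quadratics s.
Proof. by move=> <-; rewrite /quadratics (big_nth 0%N) big_mkord. Qed.

Unset Implicit Arguments.

Theorem theorem1 (R : realType) (n : nat) (hn : (4 <= n)%N) :
  (exists a : 'I_n -> nat, minimally_intersective R (quadratic_product a)) /\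
  (exists a : 'I_n.-1 -> nat, exists2 d : R, 0 < d &
     has_asymptotic_density
       [set b : nat | minimally_intersective R
                        (quadratic_product a * ('X^2 - (b%:Z)%:P))] d).
Proof.
have [ps [szps ups psP]] := primes_3mod4 (n - 3).
have psP' : {in ps, forall q, prime q /\ (7 < q)%N} by move=> q /psP[].
have ndvd r : prime r -> (r <= 7)%N -> ~~ (r %| \prod_(p <- ps) p)%N.
  move=> rp r7; rewrite dvdn_prod_primes //; last by move=> q /psP[].
  by apply/negP => /psP[_ _]; rewrite ltnNge r7.
have [u [uev a3 a5 a7 a8]] := adjust_residues (ndvd 2 isT isT) (ndvd 3 isT isT)
  (ndvd 5 isT isT) (ndvd 7 isT isT).
have /choice[x xP] : forall p, exists e, p \in ps -> separates ps p e.
  move=> p; have [pps|_] := boolP (p \in ps); last by exists 0%N.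
  by have [e he] := separates_exists ups psP' pps; exists e.
case: ps szps => [|p0 ps] szps in ups psP psP' ndvd uev a3 a5 a7 a8 xP *.
  by move: hn; rewrite leqNgt ltnS -subn_eq0 -szps.
set P := (\prod_(p <- p0 :: ps) p)%N in ndvd uev a3 a5 a7 a8.
pose a := (P * (u ^ 2 + 1))%N; pose c := (420 * (420 * a)).-1%N.
pose s := [seq x p | p <- ps] ++ [:: a; c; (a * c)%N].
have szs : size s = n.-1.
  rewrite size_cat size_map /=; move: szps; rewrite /=; clear -hn; move: (size ps) => k; lia.
have szs' : size (x p0 :: s) = n.
  by rewrite -[LHS]/(size s).+1 szs prednK // (leq_trans _ hn).
have P0 : (0 < P)%N.
  by rewrite /P big_seq prodn_cond_gt0 // => p /psP[/prime_gt0].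
have good b : b = x p0 %[mod 105 * P] -> minimally_intersective R (quadratics (b :: s)).
  move=> be; apply/minimally_intersective_quadratics; 
    first by rewrite /= szs; case: (n) hn => [|[]].
  pose y p := if p == p0 then b else x p.
  have sE : b :: s = [seq y p | p <- p0 :: ps] ++ [:: a; c; (a * c)%N].
    rewrite /= /y eqxx /s; congr (_ :: _ ++ _); apply/eq_in_map => p pps.
    by case: eqP pps ups => [->|//] /= ->.
  rewrite sE; apply: minimal_configuration => // p pps; rewrite /y; case: eqP => [e|_].
    by rewrite e in pps *; apply: eq_separates be (xP _ _).
  exact: xP.
split.
  exists (fun i => nth 0%N (x p0 :: s) i); rewrite quadratic_product_nth ?szs' //.
  exact: good.
exists (fun i => nth 0%N s i).
set A := [set b | _].
have AE : A = [set b | minimally_intersective R (quadratics (b :: s))].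
  rewrite /A quadratic_product_nth //; apply/seteqP; split=> b /=;
  by rewrite /quadratics big_cons mulrC.
have [|d dens] := @almost_periodic_density R A.
  rewrite AE; apply: almost_periodic_minimally_intersective.
  by rewrite szs; lia.
exists d => //; apply: (asymptotic_density_gt0 (Q := 105 * P) (b0 := x p0)) dens.
  by rewrite muln_gt0 P0.
by move=> b be; rewrite AE; apply: good.
Qed.
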